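(* Let $G$ be a finite group, $\mathcal{C}$ a ribbon fusion category, and let $\mathcal{C}^{\times}_G=\mathcal{C}$ be regarded as a $G$-crossed braided spherical fusion category ($G$-BSFC) with trivial $G$-grading ($\mathcal{C}_e=\mathcal{C}$ and $\mathcal{C}_g=0$ for $g\ne e$) and trivial $G$-action. Let $\omega\in H^4(G,U(1))$. Then for every closed oriented smooth $4$-manifold $M$ with ordered triangulation $\mathcal{T}$, $$Z_{\mathcal{C}^{\times}_G,\omega}(M;\mathcal{T})=DW_G^{\omega}(M)\,CY_{\mathcal{C}}(M),$$ where $DW_G^{\omega}(M)$ is the $\omega$-twisted Dijkgraaf-Witten invariant and $CY_{\mathcal{C}}(M)$ is the Crane-Yetter invariant. In particular, if $\mathcal{C}^{\times}_G=\mathcal{V}ect$ is the category of finite-dimensional vector spaces, then $Z_{\mathcal{C}^{\times}_G,\omega}(M;\mathcal{T})=DW_G^{\omega}(M)$.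
   Context: Categories are $\mathbb{C}$-linear. The $G$-crossed braiding of the $G$-BSFC $\mathcal{C}^{\times}_G=\mathcal{C}$ is the braiding $c$ of $\mathcal{C}$; $G$ acts by the identity functor. $L(\mathcal{C})$ is the set of isomorphism classes of simple objects, $d_a$ the quantum dimension of $a$, $D^2=\sum_{a\in L(\mathcal{C})}d_a^2$. Associators and unitors are suppressed. **Colorings.** Triangulations of a smooth $4$-manifold are triangulations of its underlying PL structure. An ordered triangulation $\mathcal{T}$ of $M$ is a triangulation with a total ordering of its vertices; $\mathcal{T}^k$ is its set of $k$-simplices. The vertices of a $k$-simplex are relabeled $0,1,\dots,k$ in increasing order and the simplex is written $(01\cdots k)$. For $\sigma\in\mathcal{T}^4$, $\epsilon(\sigma)=+$ if the orientation of $\sigma$ from $M$ agrees with the one given by the vertex order, $-$ otherwise. For a general $G$-BSFC a coloring is a pair $F=(g,f)$, $g:\mathcal{T}^1\to G$, $f:\mathcal{T}^2\to L(\mathcal{C}^{\times}_G)$ with $f(012)$ in the sector $\mathcal{C}_{g(02)^{-1}g(01)g(12)}$ for every $(012)\in\mathcal{T}^2$; for a trivially graded one this means that $f:\mathcal{T}^2\to L(\mathcal{C})$ is arbitrary and $g_{02}=g_{01}g_{12}$ for every $2$-simplex, where $g_{ij}=g(ij)$. Choose a representative $f_{ijk}$ of each $f(ijk)$. For $(0123)\in\mathcal{T}^3$ put (the $G$-action being trivial) $$V_F^{+}(0123)=\mathrm{Hom}(f_{023}\otimes f_{012},\,f_{013}\otimes f_{123}),\qquad V_F^{-}(0123)=\mathrm{Hom}(f_{013}\otimes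 f_{123},\,f_{023}\otimes f_{012}).$$ The pairing $\langle\phi,\psi\rangle=\mathrm{Tr}(\phi\psi)$ on $\mathrm{Hom}(X,Y)\times\mathrm{Hom}(Y,X)$ ($\mathrm{Tr}$ the spherical trace) is nondegenerate. For $(01234)\in\mathcal{T}^4$ let $c=c_{f_{234},f_{012}}:f_{234}\otimes f_{012}\to f_{012}\otimes f_{234}$. For $\phi_0\in V_F^{+}(0234),\phi_1\in V_F^{+}(0124),\phi_2\in V_F^{-}(1234),\phi_3\in V_F^{-}(0134),\phi_4\in V_F^{-}(0123)$ let $\tilde Z^{+}_F(\phi_0\otimes\cdots\otimes\phi_4)$ be the trace of the endomorphism $$(\mathrm{id}_{f_{034}}\otimes\phi_4)(\phi_3\otimes\mathrm{id}_{f_{123}})(\mathrm{id}_{f_{014}}\otimes\phi_2)(\phi_1\otimes\mathrm{id}_{f_{234}})(\mathrm{id}_{f_{024}}\otimes c)(\phi_0\otimes\mathrm{id}_{f_{012}})$$ of $f_{034}\otimes f_{023}\otimes f_{012}$. For $\psi_0\in V_F^{-}(0234),\psi_1\in V_F^{-}(0124),\psi_2\in V_F^{+}(1234),\psi_3\in V_F^{+}(0134),\psi_4\in V_F^{+}(0123)$ let $\tilde Z^{-}_F(\psi_0\otimes\cdots\otimes\psi_4)$ be the trace of $$(\psi_0\otimes\mathrm{id}_{f_{012}})(\mathrm{id}_{f_{024}}\otimes c^{-1})(\psi_1\otimes\mathrm{id}_{f_{234}})(\mathrm{id}_{f_{014}}\otimes\psi_2)(\psi_3\otimes\mathrm{id}_{f_{123}})(\mathrm{id}_{f_{034}}\otimes\psi_4).$$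 Define $Z_F^{+}(01234):V_F^{+}(0234)\otimes V_F^{+}(0124)\to V_F^{+}(1234)\otimes V_F^{+}(0134)\otimes V_F^{+}(0123)$ and $Z_F^{-}(01234)$ in the opposite direction by $\langle Z_F^{+}(\phi_0\otimes\phi_1),\phi_2\otimes\phi_3\otimes\phi_4\rangle=\tilde Z_F^{+}(\phi_0\otimes\cdots\otimes\phi_4)$ and $\langle\psi_0\otimes\psi_1,Z_F^{-}(\psi_2\otimes\psi_3\otimes\psi_4)\rangle=\tilde Z_F^{-}(\psi_0\otimes\cdots\otimes\psi_4)$. The tensor product over $\sigma\in\mathcal{T}^4$ of the $Z_F^{\epsilon(\sigma)}(\sigma)$ is an endomorphism of $\bigotimes_{\tau\in\mathcal{T}^3}V_F^{+}(\tau)$. **Twisted partition function.** With $\omega:G^4\to U(1)$ also denoting a representing $4$-cocycle and each $\sigma\in\mathcal{T}^4$ written $(01234)$, $$Z_{\mathcal{C}^{\times}_G,\omega}(M;\mathcal{T})=\sum_{F=(g,f)}\frac{(D^2/|G|)^{|\mathcal{T}^0|}\Big(\prod_{\beta\in\mathcal{T}^2}d_{f(\beta)}\Big)\mathrm{Tr}\Big(\bigotimes_{\sigma\in\mathcal{T}^4}Z_F^{\epsilon(\sigma)}(\sigma)\,\omega(g_{01},g_{12},g_{23},g_{34})^{\epsilon(\sigma)}\Big)}{(D^2)^{|\mathcal{T}^1|}},$$ where $\omega(\cdots)^{\epsilon(\sigma)}=\omega(\cdots)^{\pm1}$ according to $\epsilon(\sigma)=\pm$. **Crane-Yetter invariant.**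 $CY_{\mathcal{C}}(M)=\sum_{f}(D^2)^{|\mathcal{T}^0|-|\mathcal{T}^1|}\prod_{\beta\in\mathcal{T}^2}d_{f(\beta)}\,\mathrm{Tr}\big(\bigotimes_{\sigma}Z_f^{\epsilon(\sigma)}(\sigma)\big)$, summed over all $f:\mathcal{T}^2\to L(\mathcal{C})$, where $Z_f^{\pm}(\sigma)$ denotes the linear map $Z_F^{\pm}(\sigma)$, for any coloring $F=(g,f)$, determined by $\langle Z_F^{+}(\phi_0\otimes\phi_1),\phi_2\otimes\phi_3\otimes\phi_4\rangle=\tilde Z_F^{+}(\phi_0\otimes\cdots\otimes\phi_4)$ and $\langle\psi_0\otimes\psi_1,Z_F^{-}(\psi_2\otimes\psi_3\otimes\psi_4)\rangle=\tilde Z_F^{-}(\psi_0\otimes\cdots\otimes\psi_4)$ (it depends only on $f$). **Twisted Dijkgraaf-Witten invariant.** $DW_G^{\omega}(M)=|G|^{-|\mathcal{T}^0|}\sum_{g}\prod_{\sigma\in\mathcal{T}^4}\omega(g_{01},g_{12},g_{23},g_{34})^{\epsilon(\sigma)}$, summed over all $g:\mathcal{T}^1\to G$ with $g_{02}=g_{01}g_{12}$ on every $2$-simplex. *)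

(* Defs.v *)
From HB Require Import structures.
From mathcomp Require Import all_boot all_order all_fingroup all_algebra.
From mathcomp Require Import boolp classical_sets functions reals topology.
From mathcomp Require Import normedtype derive.
From mathcomp Require Import complex.

Set Implicit Arguments.
Unset Strict Implicit.
Unset Printing Implicit Defensive.

Import Order.TTheory GRing.Theory Num.Theory.
Import numFieldNormedType.Exports.
Local Open Scope classical_set_scope.
Local Open Scope ring_scope.

(** [V ⊗ W] is modelled by the coefficient matrices with respect to the
    library's bases of [V] and [W]; [tlift B] is the linear map induced by a
    bilinear [B] (lemmas [tlift_pure] and [tens_ext] are the universal
    property). *)

Section TensorProduct.
Variable K : fieldType.
Implicit Types V W U : vectType K.

Definition tens V W : vectType K := 'M[K]_(\dim {:V}, \dim {:W}).

Definition pure V W (v : V) (w : W) : tens V W :=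
  \matrix_(i, j) (coord (vbasis {:V}) i v * coord (vbasis {:W}) j w).

Definition tlift V W U (B : V -> W -> U) : 'Hom(tens V W, U) :=
  linfun (fun t : tens V W =>
    \sum_i \sum_j t i j *: B (vbasis {:V})`_i (vbasis {:W})`_j).

Lemma linfunE V W (f : V -> W) : linear f -> linfun f =1 f.
Proof.
move=> lf v; pose m := GRing.isLinear.Build K V W _ f lf.
pose g : {linear V -> W} := HB.pack f m.
exact: (lfunE g).
Qed.

Lemma tliftE V W U (B : V -> W -> U) t :
  tlift B t = \sum_i \sum_j t i j *: B (vbasis {:V})`_i (vbasis {:W})`_j.
Proof.
rewrite /tlift linfunE // => k x y.
rewrite scaler_sumr -big_split; apply: eq_bigr => i _ /=.
rewrite scaler_sumr -big_split; apply: eq_bigr => j _ /=.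
by rewrite !mxE scalerDl scalerA.
Qed.

Definition bilin V W U (B : V -> W -> U) :=
  (forall w, linear (B ^~ w)) /\ (forall v, linear (B v)).

Lemma linear_sum_ext V W (f : V -> W) : linear f ->
  forall (I : finType) (c : I -> K) (v : I -> V),
    f (\sum_i c i *: v i) = \sum_i c i *: f (v i).
Proof.
move=> lf I c v; rewrite -(linfunE lf) linear_sum.
by apply: eq_bigr => i _; rewrite linearZ /= linfunE.
Qed.

Lemma tlift_pure V W U (B : V -> W -> U) v w :
  bilin B -> tlift B (pure v w) = B v w.
Proof.
move=> [Bl Br]; rewrite tliftE.
rewrite {2}(coord_vbasis (memvf v)) (linear_sum_ext (Bl w)).
apply: eq_bigr => i _ /=; rewrite {2}(coord_vbasis (memvf w)).
rewrite (linear_sum_ext (Br _)) scaler_sumr.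
by apply: eq_bigr => j _; rewrite mxE scalerA.
Qed.

Lemma bilin_pure V W : bilin (@pure V W).
Proof.
split=> [w k x y|v k x y]; apply/matrixP => i j; rewrite !mxE linearP.
  by rewrite mulrDl mulrA.
by rewrite mulrDr mulrCA.
Qed.

Lemma pure_basis V W (i : 'I_(\dim {:V})) (j : 'I_(\dim {:W})) :
  pure (vbasis {:V})`_i (vbasis {:W})`_j = delta_mx i j.
Proof.
apply/matrixP => a b; rewrite !mxE.
rewrite !coord_free ?(basis_free (vbasisP _)) // -natrM mulnb.
by rewrite (eq_sym i) (eq_sym j).
Qed.

Lemma tens_sum V W (t : tens V W) :
  t = \sum_i \sum_j t i j *: pure (vbasis {:V})`_i (vbasis {:W})`_j.
Proof.
rewrite {1}[t]matrix_sum_delta; apply: eq_bigr => i _; apply: eq_bigr => j _.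
by rewrite pure_basis.
Qed.

Lemma tens_ext V W U (f g : 'Hom(tens V W, U)) :
  (forall v w, f (pure v w) = g (pure v w)) -> f = g.
Proof.
move=> fg; apply/lfunP => t; rewrite [t]tens_sum !linear_sum.
apply: eq_bigr => i _; rewrite !linear_sum; apply: eq_bigr => j _.
by rewrite !linearZ /= fg.
Qed.

Definition basis_vec V (k : nat) : V := (vbasis {:V})`_k.

(* [0] when [k] is not an index of the basis *)
Definition basis_coord V (k : nat) (v : V) : K :=
  if insub k is Some i then coord (vbasis {:V}) i v else 0.

End TensorProduct.

Section LinearCategory.
Variable K : fieldType.

Record linearCategory := LinearCategory {
  Ob :> Type;
  mor : Ob -> Ob -> vectType K;
  idm : forall X, mor X X;
  comp : forall X Y Z, mor Y Z -> mor X Y -> mor X Z;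
  compA : forall W X Y Z (h : mor Y Z) (g : mor X Y) (f : mor W X),
    comp h (comp g f) = comp (comp h g) f;
  comp1m : forall X Y (f : mor X Y), comp (idm Y) f = f;
  compm1 : forall X Y (f : mor X Y), comp f (idm X) = f;
  comp_bilin : forall X Y Z, bilin (@comp X Y Z) }.

End LinearCategory.

Arguments mor {K l} X Y.
Arguments idm {K l} X.
Arguments comp {K l X Y Z} g f : rename.
Notation "g \oc f" := (comp g f) (at level 50, left associativity).

Section CategoryNotions.
Variables (K : fieldType) (C : linearCategory K).
Implicit Types X Y Z : C.

Definition is_iso X Y (f : mor X Y) :=
  exists g : mor Y X, g \oc f = idm X /\ f \oc g = idm Y.

Definition isomorphic X Y := exists f : mor X Y, is_iso f.

Definition is_mono X Y (f : mor X Y) :=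
  forall W (g h : mor W X), f \oc g = f \oc h -> g = h.

Definition is_epi X Y (f : mor X Y) :=
  forall W (g h : mor Y W), g \oc f = h \oc f -> g = h.

Definition is_zero X := idm X = 0.

Definition is_kernel X Y Z (f : mor Y Z) (k : mor X Y) :=
  f \oc k = 0 /\
  forall W (h : mor W Y), f \oc h = 0 -> exists! u : mor W X, k \oc u = h.

Definition is_cokernel X Y Z (f : mor X Y) (q : mor Y Z) :=
  q \oc f = 0 /\
  forall W (h : mor Y W), h \oc f = 0 -> exists! u : mor Z W, u \oc q = h.

Definition is_direct_sum n (S : 'I_n -> C) X :=
  exists (i : forall k, mor (S k) X) (p : forall k, mor X (S k)),
    [/\ forall k, p k \oc i k = idm (S k),
        forall k l, k != l -> p k \oc i l = 0
      & \sum_k (i k \oc p k) = idm X].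

Definition abelian_category :=
  [/\ forall n (S : 'I_n -> C), exists X, is_direct_sum S X,
      forall X Y (f : mor X Y), exists Z (k : mor Z X), is_kernel f k,
      forall X Y (f : mor X Y), exists Z (q : mor Y Z), is_cokernel f q,
      forall X Y (f : mor X Y), is_mono f ->
        exists Z (g : mor Y Z), is_kernel g f
    & forall X Y (f : mor X Y), is_epi f ->
        exists Z (g : mor Z X), is_cokernel g f].

Definition simple X :=
  ~ is_zero X /\
  forall Y (f : mor Y X), is_mono f -> is_zero Y \/ is_iso f.

Definition semisimple_category :=
  forall X, exists n (S : 'I_n -> C), (forall k, simple (S k)) /\
    is_direct_sum S X.

End CategoryNotions.

Record monoidalCategory (K : fieldType) := MonoidalCategory {
  mcat :> linearCategory K;
  tob : mcat -> mcat -> mcat;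
  tmor : forall X X' Y Y' : mcat,
    mor X X' -> mor Y Y' -> mor (tob X Y) (tob X' Y');
  tmor_bilin : forall X X' Y Y', bilin (@tmor X X' Y Y');
  tmor1 : forall X Y, tmor (idm X) (idm Y) = idm (tob X Y);
  tmor_comp : forall (X X' X'' Y Y' Y'' : mcat)
      (f' : mor X' X'') (f : mor X X') (g' : mor Y' Y'') (g : mor Y Y'),
    tmor (f' \oc f) (g' \oc g) = tmor f' g' \oc tmor f g;
  tunit : mcat;
  assoc : forall X Y Z, mor (tob (tob X Y) Z) (tob X (tob Y Z));
  associ : forall X Y Z, mor (tob X (tob Y Z)) (tob (tob X Y) Z);
  assocK : forall X Y Z, associ X Y Z \oc assoc X Y Z = idm _;
  associK : forall X Y Z, assoc X Y Z \oc associ X Y Z = idm _;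
  assoc_nat : forall (X X' Y Y' Z Z' : mcat)
      (f : mor X X') (g : mor Y Y') (h : mor Z Z'),
    assoc X' Y' Z' \oc tmor (tmor f g) h = tmor f (tmor g h) \oc assoc X Y Z;
  lunit : forall X, mor (tob tunit X) X;
  runit : forall X, mor (tob X tunit) X;
  lunit_iso : forall X, is_iso (lunit X);
  runit_iso : forall X, is_iso (runit X);
  lunit_nat : forall (X Y : mcat) (f : mor X Y),
    lunit Y \oc tmor (idm tunit) f = f \oc lunit X;
  runit_nat : forall (X Y : mcat) (f : mor X Y),
    runit Y \oc tmor f (idm tunit) = f \oc runit X;
  pentagon : forall W X Y Z : mcat,
    assoc W X (tob Y Z) \oc assoc (tob W X) Y Z =
    tmor (idm W) (assoc X Y Z) \oc assoc W (tob X Y) Z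
      \oc tmor (assoc W X Y) (idm Z);
  triangle : forall X Y : mcat,
    tmor (idm X) (lunit Y) \oc assoc X tunit Y = tmor (runit X) (idm Y) }.

Arguments tob {K m} X Y.
Arguments tmor {K m X X' Y Y'} f g.
Arguments tunit {K m}.
Arguments assoc {K m} X Y Z.
Arguments associ {K m} X Y Z.
Arguments lunit {K m} X.
Arguments runit {K m} X.
Notation "X \ot Y" := (tob X Y) (at level 40, left associativity).
Notation "f \om g" := (tmor f g) (at level 40, left associativity).

(* The duality is a left duality; with the braiding it makes every object
   rigid on both sides. *)
Record ribbonCategory (K : fieldType) := RibbonCategory {
  rcat :> monoidalCategory K;
  dual : rcat -> rcat;
  ev : forall X, mor (dual X \ot X) tunit;
  coev : forall X, mor tunit (X \ot dual X);
  zigzag : forall X : rcat,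
    runit X \oc (idm X \om ev X) \oc assoc X (dual X) X \oc (coev X \om idm X)
    = lunit X;
  zigzag_dual : forall X : rcat,
    lunit (dual X) \oc (ev X \om idm (dual X)) \oc associ (dual X) X (dual X)
      \oc (idm (dual X) \om coev X) = runit (dual X);
  braid : forall X Y : rcat, mor (X \ot Y) (Y \ot X);
  braidi : forall X Y : rcat, mor (Y \ot X) (X \ot Y);
  braidK : forall X Y, braidi X Y \oc braid X Y = idm _;
  braidiK : forall X Y, braid X Y \oc braidi X Y = idm _;
  braid_nat : forall (X X' Y Y' : rcat) (f : mor X X') (g : mor Y Y'),
    braid X' Y' \oc (f \om g) = (g \om f) \oc braid X Y;
  hexagon : forall X Y Z : rcat,
    assoc Y Z X \oc braid X (Y \ot Z) \oc assoc X Y Z =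
    (idm Y \om braid X Z) \oc assoc Y X Z \oc (braid X Y \om idm Z);
  hexagon_inv : forall X Y Z : rcat,
    associ Z X Y \oc braid (X \ot Y) Z \oc associ X Y Z =
    (braid X Z \om idm Y) \oc associ X Z Y \oc (idm X \om braid Y Z);
  twist : forall X : rcat, mor X X;
  twist_iso : forall X, is_iso (twist X);
  twist_nat : forall (X Y : rcat) (f : mor X Y),
    twist Y \oc f = f \oc twist X;
  twist_tens : forall X Y : rcat,
    twist (X \ot Y) = braid Y X \oc braid X Y \oc (twist X \om twist Y);
  twist_dual : forall X : rcat,
    (twist X \om idm (dual X)) \oc coev X
    = (idm X \om twist (dual X)) \oc coev X }.

Arguments dual {K r} X.
Arguments ev {K r} X.
Arguments coev {K r} X.
Arguments braid {K r} X Y.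
Arguments braidi {K r} X Y.
Arguments twist {K r} X.

(* [irr] enumerates the isomorphism classes of simple objects and [rep a] is
   the chosen representative of the class [a]. *)
Record ribbonFusionCategory (K : fieldType) := RibbonFusionCategory {
  fcat :> ribbonCategory K;
  fusion_abelian : abelian_category fcat;
  fusion_semisimple : semisimple_category fcat;
  tunit_simple : simple (@tunit K fcat);
  irr : finType;
  rep : irr -> fcat;
  rep_simple : forall a, simple (rep a);
  rep_inj : forall a b, isomorphic (rep a) (rep b) -> a = b;
  rep_surj : forall X, simple X -> exists a, isomorphic X (rep a) }.

Arguments irr {K} r.
Arguments rep {K r} a.

Section Trace.
Variables (K : fieldType) (C : ribbonCategory K).

(* the scalar [k] such that [f = k *: idm tunit]; [idm tunit] is a basis of
   the endomorphism space of the unit when the latter is one-dimensional *)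
Definition unit_scalar (f : mor (@tunit K C) tunit) : K :=
  coord [tuple idm tunit] ord0 f.

Definition Tr (X : C) (f : mor X X) : K :=
  unit_scalar (ev X \oc braid X (dual X) \oc ((twist X \oc f) \om idm (dual X))
               \oc coev X).

Definition qdim (X : C) : K := Tr (idm X).

Definition pairing (X Y : C) (f : mor X Y) (g : mor Y X) : K := Tr (f \oc g).

End Trace.

Definition globalDim2 (K : fieldType) (C : ribbonFusionCategory K) : K :=
  \sum_(a : irr C) qdim (rep a) ^+ 2.

Section Vect.
Variable K : fieldType.
Implicit Types U V W X Y : vectType K.

Lemma comp_lfun_bilin U V W : bilin (@comp_lfun K U V W).
Proof.
split=> [f k g h|g k f h].
  by rewrite comp_lfunDl comp_lfunZl.
by rewrite comp_lfunDr comp_lfunZr.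
Qed.

Definition vectLinear : linearCategory K :=
  @LinearCategory K (vectType K) (fun V W => 'Hom(V, W)) (fun V => \1%VF)
    (fun U V W g f => (g \o f)%VF) (fun U V W X h g f => comp_lfunA h g f)
    (fun V W f => comp_lfun1l f) (fun V W f => comp_lfun1r f)
    comp_lfun_bilin.

Definition tensm V V' W W' (f : 'Hom(V, V')) (g : 'Hom(W, W')) :
    'Hom(tens V W, tens V' W') :=
  tlift (fun v w => pure (f v) (g w)).

Lemma tensmE V V' W W' (f : 'Hom(V, V')) (g : 'Hom(W, W')) v w :
  tensm f g (pure v w) = pure (f v) (g w).
Proof.
rewrite tlift_pure //; split=> [y k x z|x k y z]; rewrite linearP.
  exact: (bilin_pure _ _).1.
exact: (bilin_pure _ _).2.
Qed.

Lemma tensm_bilin V V' W W' : bilin (@tensm V V' W W').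
Proof.
split=> [g k f h|f k g h]; apply: tens_ext => v w;
  rewrite add_lfunE scale_lfunE !tensmE add_lfunE scale_lfunE.
  exact: (bilin_pure _ _).1.
exact: (bilin_pure _ _).2.
Qed.

Lemma tensm1 V W : tensm (\1 : 'End(V))%VF (\1 : 'End(W))%VF = \1%VF.
Proof. by apply: tens_ext => v w; rewrite tensmE !id_lfunE. Qed.

Lemma tensm_comp (V V' V'' W W' W'' : vectType K)
    (f' : 'Hom(V', V'')) (f : 'Hom(V, V'))
    (g' : 'Hom(W', W'')) (g : 'Hom(W, W')) :
  tensm (f' \o f)%VF (g' \o g)%VF = (tensm f' g' \o tensm f g)%VF.
Proof. by apply: tens_ext => v w; rewrite comp_lfunE !tensmE !comp_lfunE. Qed.

Lemma tlift_linear U V W X (B : X -> V -> W -> U) :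
  (forall v w, linear (fun x => B x v w)) ->
  forall t, linear (fun x => tlift (B x) t).
Proof.
move=> lB t k x y; rewrite !tliftE scaler_sumr -big_split.
apply: eq_bigr => i _ /=; rewrite scaler_sumr -big_split.
by apply: eq_bigr => j _ /=; rewrite lB scalerDr !scalerA mulrC.
Qed.

Definition tassoc U V W : 'Hom(tens (tens U V) W, tens U (tens V W)) :=
  tlift (fun t w => tlift (fun u v => pure u (pure v w)) t).

Lemma tassocE U V W (u : U) (v : V) (w : W) :
  tassoc U V W (pure (pure u v) w) = pure u (pure v w).
Proof.
rewrite !tlift_pure //.
  split=> [y k x z|x k y z].
    exact: (bilin_pure _ _).1.
  by rewrite (bilin_pure _ _).1 (bilin_pure _ _).2.
split=> [y k x z|x]; first by rewrite linearP.
apply: tlift_linear => u' v' k y z.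
by rewrite (bilin_pure _ _).2 (bilin_pure _ _).2.
Qed.

Definition tassoci U V W : 'Hom(tens U (tens V W), tens (tens U V) W) :=
  tlift (fun u t => tlift (fun v w => pure (pure u v) w) t).

Lemma tassociE U V W (u : U) (v : V) (w : W) :
  tassoci U V W (pure u (pure v w)) = pure (pure u v) w.
Proof.
rewrite !tlift_pure //.
  split=> [y k x z|x k y z].
    by rewrite (bilin_pure _ _).2 (bilin_pure _ _).1.
  exact: (bilin_pure _ _).2.
split=> [y|x k y z]; last by rewrite linearP.
apply: tlift_linear => u' v' k x z.
by rewrite (bilin_pure _ _).1 (bilin_pure _ _).1.
Qed.

Lemma tens_ext3 U V W X (f g : 'Hom(tens (tens U V) W, X)) :
  (forall u v w, f (pure (pure u v) w) = g (pure (pure u v) w)) -> f = g.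
Proof.
move=> fg; apply: tens_ext => t w.
have l1 : linear (fun t : tens U V => pure t w) := (bilin_pure _ _).1 w.
rewrite -(linfunE l1) -2!comp_lfunE; congr (fun_of_lfun _ t).
by apply: tens_ext => u v; rewrite !comp_lfunE !linfunE.
Qed.

Lemma tens_ext3r U V W X (f g : 'Hom(tens U (tens V W), X)) :
  (forall u v w, f (pure u (pure v w)) = g (pure u (pure v w))) -> f = g.
Proof.
move=> fg; apply: tens_ext => u t.
have l1 : linear (fun t : tens V W => pure u t) := (bilin_pure _ _).2 u.
rewrite -(linfunE l1) -2!comp_lfunE; congr (fun_of_lfun _ t).
by apply: tens_ext => v w; rewrite !comp_lfunE !linfunE.
Qed.

Lemma tens_ext4 U V W Y X (f g : 'Hom(tens (tens (tens U V) W) Y, X)) :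
  (forall u v w y, f (pure (pure (pure u v) w) y) =
                   g (pure (pure (pure u v) w) y)) -> f = g.
Proof.
move=> fg; apply: tens_ext => t y.
have l1 : linear (fun t : tens (tens U V) W => pure t y) :=
  (bilin_pure _ _).1 y.
rewrite -(linfunE l1) -2!comp_lfunE; congr (fun_of_lfun _ t).
by apply: tens_ext3 => u v w; rewrite !comp_lfunE !linfunE.
Qed.

Lemma tassocK U V W : (tassoci U V W \o tassoc U V W = \1)%VF.
Proof.
by apply: tens_ext3 => u v w; rewrite comp_lfunE tassocE tassociE id_lfunE.
Qed.

Lemma tassociK U V W : (tassoc U V W \o tassoci U V W = \1)%VF.
Proof.
by apply: tens_ext3r => u v w; rewrite comp_lfunE tassociE tassocE id_lfunE.
Qed.

Lemma tassoc_nat U U' V V' W W'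
    (f : 'Hom(U, U')) (g : 'Hom(V, V')) (h : 'Hom(W, W')) :
  (tassoc U' V' W' \o tensm (tensm f g) h =
   tensm f (tensm g h) \o tassoc U V W)%VF.
Proof.
by apply: tens_ext3 => u v w; rewrite !comp_lfunE tassocE !tensmE tassocE.
Qed.

Definition tlunit V : 'Hom(tens K^o V, V) := tlift (fun (k : K^o) v => k *: v).
Definition trunit V : 'Hom(tens V K^o, V) := tlift (fun v (k : K^o) => k *: v).

Lemma tlunitE V (k : K^o) (v : V) : tlunit V (pure k v) = k *: v.
Proof.
rewrite tlift_pure //; split=> [w a x y|a b x y].
  by rewrite scalerDl scalerA.
by rewrite scalerDr !scalerA mulrC.
Qed.

Lemma trunitE V (k : K^o) (v : V) : trunit V (pure v k) = k *: v.
Proof.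
rewrite tlift_pure //; split=> [a b x y|w a x y].
  by rewrite scalerDr !scalerA mulrC.
by rewrite scalerDl scalerA.
Qed.

Lemma bilinZl U V W (B : U -> V -> W) (hB : bilin B) k u v :
  B (k *: u) v = k *: B u v.
Proof. by rewrite -!(linfunE (hB.1 v)) linearZ. Qed.

Lemma bilinZr U V W (B : U -> V -> W) (hB : bilin B) k u v :
  B u (k *: v) = k *: B u v.
Proof. by rewrite -!(linfunE (hB.2 u)) linearZ. Qed.

Lemma vect_isoI V W (f : 'Hom(V, W)) (g : 'Hom(W, V)) :
  (g \o f = \1)%VF -> (f \o g = \1)%VF -> @is_iso K vectLinear _ _ f.
Proof. by move=> gf fg; exists g. Qed.

Lemma tlunit_iso V : @is_iso K vectLinear _ _ (tlunit V).
Proof.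
have l1 : linear (fun v : V => pure (1 : K^o) v) := (bilin_pure _ _).2 _.
apply: (@vect_isoI _ _ _ (linfun (fun v : V => pure (1 : K^o) v))).
  apply: tens_ext => k v; rewrite comp_lfunE id_lfunE tlunitE linfunE //.
  rewrite (bilinZr (bilin_pure _ _)) -(bilinZl (bilin_pure _ _)).
  by rewrite /GRing.scale /= mulr1.
by apply/lfunP => v; rewrite comp_lfunE linfunE // tlunitE scale1r id_lfunE.
Qed.

Lemma trunit_iso V : @is_iso K vectLinear _ _ (trunit V).
Proof.
have l1 : linear (fun v : V => pure v (1 : K^o)) := (bilin_pure _ _).1 _.
apply: (@vect_isoI _ _ _ (linfun (fun v : V => pure v (1 : K^o)))).
  apply: tens_ext => v k; rewrite comp_lfunE id_lfunE trunitE linfunE //.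
  rewrite (bilinZl (bilin_pure _ _)) -(bilinZr (bilin_pure _ _)).
  by rewrite /GRing.scale /= mulr1.
by apply/lfunP => v; rewrite comp_lfunE linfunE // trunitE scale1r id_lfunE.
Qed.

Lemma tlunit_nat V W (f : 'Hom(V, W)) :
  (tlunit W \o tensm \1%VF f = f \o tlunit V)%VF.
Proof.
apply: tens_ext => k v.
by rewrite !comp_lfunE tensmE !tlunitE id_lfunE linearZ.
Qed.

Lemma trunit_nat V W (f : 'Hom(V, W)) :
  (trunit W \o tensm f \1%VF = f \o trunit V)%VF.
Proof.
apply: tens_ext => v k.
by rewrite !comp_lfunE tensmE !trunitE id_lfunE linearZ.
Qed.

Lemma tpentagon U V W X :
  (tassoc U V (tens W X) \o tassoc (tens U V) W X =
   tensm \1 (tassoc V W X) \o tassoc U (tens V W) X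
     \o tensm (tassoc U V W) \1)%VF.
Proof.
apply: tens_ext4 => u v w x.
by rewrite !comp_lfunE !tensmE !tassocE !tensmE !tassocE !id_lfunE.
Qed.

Lemma ttriangle U V :
  (tensm \1 (tlunit V) \o tassoc U K^o V = tensm (trunit U) \1)%VF.
Proof.
apply: tens_ext3 => u k v.
rewrite comp_lfunE tassocE !tensmE tlunitE trunitE !id_lfunE.
by rewrite (bilinZr (bilin_pure _ _)) -(bilinZl (bilin_pure _ _)).
Qed.

Definition vectMonoidal : monoidalCategory K :=
  @MonoidalCategory K vectLinear (@tens K) tensm tensm_bilin tensm1 tensm_comp
    (K^o : vectType K) tassoc tassoci tassocK tassociK tassoc_nat tlunit trunit
    tlunit_iso trunit_iso tlunit_nat trunit_nat tpentagon ttriangle.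

Definition vdual V : vectType K := 'Hom(V, K^o).

Definition tev V : 'Hom(tens (vdual V) V, K^o) :=
  tlift (fun (l : vdual V) (v : V) => l v).

Lemma tevE V (l : vdual V) (v : V) : tev V (pure l v) = l v.
Proof.
rewrite tlift_pure //; split=> [w k f g|g k x y].
  by rewrite add_lfunE scale_lfunE.
by rewrite linearP.
Qed.

Definition vcoord V (i : 'I_(\dim {:V})) : vdual V :=
  linfun (fun v : V => coord (vbasis {:V}) i v : K^o).

Lemma vcoordE V (i : 'I_(\dim {:V})) v :
  vcoord i v = coord (vbasis {:V}) i v.
Proof. by rewrite linfunE // => k x y; rewrite linearP. Qed.

Definition tcoev V : 'Hom(K^o, tens V (vdual V)) :=
  linfun (fun k : K^o => k *: \sum_(i < \dim {:V}) pure (vbasis {:V})`_i (vcoord i)).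

Lemma tcoevE V (k : K^o) :
  tcoev V k = k *: \sum_(i < \dim {:V}) pure (vbasis {:V})`_i (vcoord i).
Proof. by rewrite linfunE // => a x y; rewrite scalerDl scalerA. Qed.

Lemma bilin_suml U V W (B : U -> V -> W) (hB : bilin B) n (u : 'I_n -> U) v :
  B (\sum_i u i) v = \sum_i B (u i) v.
Proof.
rewrite -(linfunE (hB.1 v)) linear_sum.
by apply: eq_bigr => i _ /=; rewrite linfunE //; apply: hB.1.
Qed.

Lemma bilin_sumr U V W (B : U -> V -> W) (hB : bilin B) n u (v : 'I_n -> V) :
  B u (\sum_i v i) = \sum_i B u (v i).
Proof.
rewrite -(linfunE (hB.2 u)) linear_sum.
by apply: eq_bigr => i _ /=; rewrite linfunE //; apply: hB.2.
Qed.

Lemma tzigzag V :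
  (trunit V \o tensm \1 (tev V) \o tassoc V (vdual V) V \o tensm (tcoev V) \1
   = tlunit V)%VF.
Proof.
apply: tens_ext => k v; rewrite !comp_lfunE tensmE tcoevE id_lfunE tlunitE.
rewrite (bilinZl (bilin_pure _ _)) !linearZ (bilin_suml (bilin_pure _ _)) /=.
congr (_ *: _); rewrite !linear_sum {2}(coord_vbasis (memvf v)) /=.
apply: eq_bigr => i _.
by rewrite tassocE tensmE tevE trunitE vcoordE id_lfunE.
Qed.

Lemma tzigzag_dual V :
  (tlunit (vdual V) \o tensm (tev V) \1 \o tassoci (vdual V) V (vdual V)
    \o tensm \1 (tcoev V) = trunit (vdual V))%VF.
Proof.
apply: tens_ext => l k; rewrite !comp_lfunE tensmE tcoevE id_lfunE trunitE.
rewrite (bilinZr (bilin_pure _ _)) !linearZ (bilin_sumr (bilin_pure _ _)) /=.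
congr (_ *: _); rewrite !linear_sum /=; apply/lfunP => v.
rewrite sum_lfunE {2}(coord_vbasis (memvf v)) linear_sum /=.
apply: eq_bigr => i _.
rewrite tassociE tensmE tevE tlunitE id_lfunE scale_lfunE vcoordE linearZ /=.
by rewrite /GRing.scale /= mulrC.
Qed.

Definition tflip U V : 'Hom(tens U V, tens V U) :=
  tlift (fun u v => pure v u).

Lemma tflipE U V (u : U) (v : V) : tflip U V (pure u v) = pure v u.
Proof.
rewrite tlift_pure //; split=> [w k x y|w k x y].
  exact: (bilin_pure _ _).2.
exact: (bilin_pure _ _).1.
Qed.

Lemma tflipK U V : (tflip V U \o tflip U V = \1)%VF.
Proof. by apply: tens_ext => u v; rewrite comp_lfunE !tflipE id_lfunE. Qed.

Lemma tflip_nat U U' V V' (f : 'Hom(U, U')) (g : 'Hom(V, V')) :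
  (tflip U' V' \o tensm f g = tensm g f \o tflip U V)%VF.
Proof. by apply: tens_ext => u v; rewrite !comp_lfunE !(tensmE, tflipE). Qed.

Lemma thexagon U V W :
  (tassoc V W U \o tflip U (tens V W) \o tassoc U V W =
   tensm \1 (tflip U W) \o tassoc V U W \o tensm (tflip U V) \1)%VF.
Proof.
apply: tens_ext3 => u v w.
by rewrite !comp_lfunE !(tassocE, tensmE, tflipE) !id_lfunE.
Qed.

Lemma thexagon_inv U V W :
  (tassoci W U V \o tflip (tens U V) W \o tassoci U V W =
   tensm (tflip U W) \1 \o tassoci U W V \o tensm \1 (tflip V W))%VF.
Proof.
apply: tens_ext3r => u v w.
by rewrite !comp_lfunE !(tassociE, tensmE, tflipE) !id_lfunE.
Qed.

Lemma vect_id_iso V : @is_iso K vectLinear _ _ (\1 : 'End(V))%VF.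
Proof. by exists \1%VF; split; rewrite /= comp_lfun1l. Qed.

Lemma vect_twist_nat V W (f : 'Hom(V, W)) : (\1 \o f = f \o \1)%VF.
Proof. by rewrite comp_lfun1l comp_lfun1r. Qed.

Lemma vect_twist_tens V W :
  (\1 : 'End(tens V W))%VF = (tflip W V \o tflip V W \o tensm \1 \1)%VF.
Proof. by rewrite tflipK tensm1 comp_lfun1l. Qed.

Definition vectRibbon : ribbonCategory K :=
  @RibbonCategory K vectMonoidal vdual tev tcoev tzigzag tzigzag_dual
    tflip (fun V W => tflip W V) tflipK (fun V W => tflipK W V) tflip_nat
    thexagon thexagon_inv (fun V => \1%VF) vect_id_iso vect_twist_nat
    vect_twist_tens (fun V => erefl).

Lemma vect_mono V W (f : 'Hom(V, W)) :
  @is_mono K vectLinear _ _ f -> lker f = 0%VS.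
Proof.
move=> mf; apply/eqP/lker0P => x y fxy.
pose line z : 'Hom(K^o, V) := linfun (fun k : K^o => k *: z).
have lineE z k : line z k = k *: z.
  by rewrite linfunE // => a b c; rewrite scalerDl scalerA.
have /(congr1 (fun h => fun_of_lfun h (1 : K^o))) : line x = line y.
  by apply: mf; apply/lfunP => k; rewrite /= !comp_lfunE !lineE !linearZ /= fxy.
by rewrite !lineE !scale1r.
Qed.

Lemma vect_epi V W (f : 'Hom(V, W)) :
  @is_epi K vectLinear _ _ f -> limg f = fullv.
Proof.
move=> ef; have: projv (limg f) = \1%VF.
  apply: ef; apply/lfunP => v; rewrite /= !comp_lfunE id_lfunE.
  by rewrite projv_id // memv_img ?memvf.
by move/(congr1 (fun h => limg h)); rewrite limg_proj lim1g.
Qed.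

Lemma lfun_factorl V W U (g : 'Hom(V, W)) (h : 'Hom(V, U)) :
  (lker g <= lker h)%VS -> (h \o g^-1 \o g = h)%VF.
Proof.
move=> gh; apply/lfunP => v; rewrite !comp_lfunE.
apply/eqP; rewrite -subr_eq0 -linearB -memv_ker; apply: (subvP gh).
by rewrite memv_ker linearB /= limg_lfunVK ?subrr // memv_img ?memvf.
Qed.

Lemma lfun_factorr V W U (g : 'Hom(V, W)) (h : 'Hom(U, W)) :
  (limg h <= limg g)%VS -> (g \o (g^-1 \o h) = h)%VF.
Proof.
move=> hg; apply/lfunP => v; rewrite !comp_lfunE limg_lfunVK //.
by apply: (subvP hg); rewrite memv_img ?memvf.
Qed.

Lemma vect_is_kernel U V W (f : 'Hom(V, W)) (k : 'Hom(U, V)) :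
  lker k = 0%VS -> limg k = lker f -> @is_kernel K vectLinear _ _ _ f k.
Proof.
move=> k0 kf; split=> /= [|X h fh0].
  apply/lfunP => u; rewrite comp_lfunE zero_lfunE; apply/eqP.
  by rewrite -memv_ker -kf memv_img ?memvf.
have hk : (limg h <= limg k)%VS.
  apply/subvP => v /memv_imgP[x _ ->]; rewrite kf memv_ker.
  by rewrite -comp_lfunE fh0 zero_lfunE.
exists (k^-1 \o h)%VF; split; first exact: lfun_factorr.
move=> u ku; apply/lfunP => x; move/eqP/lker0P: k0; apply.
by rewrite -[in LHS]comp_lfunE lfun_factorr // -ku comp_lfunE.
Qed.

Lemma vect_is_cokernel U V W (f : 'Hom(U, V)) (q : 'Hom(V, W)) :
  limg q = fullv -> lker q = limg f -> @is_cokernel K vectLinear _ _ _ f q.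
Proof.
move=> q1 qf; split=> /= [|X h hf0].
  apply/lfunP => u; rewrite comp_lfunE zero_lfunE; apply/eqP.
  by rewrite -memv_ker qf memv_img ?memvf.
have hk : (lker q <= lker h)%VS.
  rewrite qf; apply/subvP => v /memv_imgP[x _ ->]; rewrite memv_ker.
  by rewrite -comp_lfunE hf0 zero_lfunE.
exists (h \o q^-1)%VF; split; first exact: lfun_factorl.
move=> u uq; apply/lfunP => w.
have /memv_imgP[v _ ->] : w \in limg q by rewrite q1 memvf.
by rewrite -[LHS]comp_lfunE lfun_factorl // -uq comp_lfunE.
Qed.

Lemma vect_inclusion V (S : {vspace V}) :
  exists f : 'Hom(subvs_of S, V), lker f = 0%VS /\ limg f = S.
Proof.
exists (linfun vsval); split.
  by apply/eqP/lker0P => x y; rewrite !lfunE => /subvs_inj.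
apply/vspaceP => v; apply/memv_imgP/idP => [[x _ ->]|vS].
  by rewrite lfunE subvsP.
by exists (vsproj S v); rewrite ?memvf // lfunE /= vsprojK.
Qed.

Lemma vect_quotient V (S : {vspace V}) :
  exists W : vectType K, exists q : 'Hom(V, W),
    limg q = fullv /\ lker q = S.
Proof.
pose r := (\1 - projv S)%VF; pose T := limg r.
have rE v : r v = v - projv S v by rewrite add_lfunE opp_lfunE id_lfunE.
have rT v : r v \in T by rewrite memv_img ?memvf.
exists (subvs_of T), (linfun (vsproj T) \o r)%VF; split.
  apply/eqP; rewrite eqEsubv subvf /=; apply/subvP => w _.
  have /memv_imgP[v _ vE] := subvsP w.
  apply/memv_imgP; exists v; rewrite ?memvf //.
  by rewrite comp_lfunE lfunE /= -vE vsvalK.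
apply/vspaceP => v; rewrite memv_ker comp_lfunE lfunE /=.
apply/eqP/idP => [rv0|vS].
  have: r v = 0 by rewrite -(vsprojK (rT v)) rv0.
  by rewrite rE => /eqP; rewrite subr_eq0 => /eqP->; rewrite memv_proj.
by rewrite rE projv_id // subrr linear0.
Qed.

Lemma vect_direct_sum n (S : 'I_n -> vectLinear) :
  exists X, is_direct_sum S X.
Proof.
pose T := {k : 'I_n & 'I_(\dim {:(S k : vectType K)})}.
pose tg (k : 'I_n) (j : 'I_(\dim {:(S k : vectType K)})) : T :=
  Tagged (fun k : 'I_n => 'I_(\dim {:(S k : vectType K)})) j.
pose X : vectType K := {ffun T -> K^o}.
pose e (u : T) : X := [ffun w => (w == u)%:R].
have exE (x : X) : x = \sum_k \sum_j x (tg k j) *: e (tg k j).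
  have tgE k j k' j' : tg k j == tg k' j' -> k = k'.
    by move/eqP/(congr1 tag).
  apply/ffunP => -[k0 j0]; rewrite sum_ffunE (bigD1 k0) //=.
  rewrite sum_ffunE (bigD1 j0) //= !big1 ?addr0 => [|k kk0|j jj0].
  - by rewrite !ffunE /= eqxx /GRing.scale /= mulr1.
  - rewrite sum_ffunE big1 // => j _; rewrite !ffunE.
    case: eqP => [/eqP/tgE kk|]; first by rewrite kk eqxx in kk0.
    by rewrite /GRing.scale /= mulr0.
  - rewrite !ffunE -tag_eqE /tag_eq /= eqxx tagged_asE eq_sym (negbTE jj0).
    by rewrite /GRing.scale /= mulr0.
pose i k : 'Hom(S k, X) := linfun (fun v : (S k : vectType K) =>
  \sum_j coord (vbasis {:(S k : vectType K)}) j v *: e (tg k j)).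
have iE k v : i k v =
    \sum_j coord (vbasis {:(S k : vectType K)}) j v *: e (tg k j).
  rewrite linfunE // => a x y; rewrite scaler_sumr -big_split.
  by apply: eq_bigr => j _; rewrite linearP /= scalerDl scalerA.
pose p k : 'Hom(X, S k) := linfun (fun x : X =>
  \sum_j x (tg k j) *: (vbasis {:(S k : vectType K)})`_j).
have pE k x : p k x =
    \sum_j x (tg k j) *: (vbasis {:(S k : vectType K)})`_j.
  rewrite linfunE // => a y z; rewrite scaler_sumr -big_split.
  by apply: eq_bigr => j _; rewrite !ffunE scalerDl scalerA.
have pe k l j : p k (e (tg l j)) =
    if k =P l is ReflectT kl then
      (vbasis {:(S k : vectType K)})`_j else 0.
  rewrite pE; case: eqP => [kl|nkl].
    subst l; rewrite (bigD1 j) //= big1 ?addr0 => [|j' jj'].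
      by rewrite ffunE eqxx scale1r.
    by rewrite ffunE -tag_eqE /tag_eq /= eqxx tagged_asE (negbTE jj') scale0r.
  rewrite big1 // => j' _; rewrite ffunE -tag_eqE /tag_eq /=.
  by rewrite (introF eqP nkl) scale0r.
exists X, i, p; split=> [k|k l kl|] /=; apply/lfunP => v.
- rewrite comp_lfunE iE linear_sum id_lfunE {2}(coord_vbasis (memvf v)).
  apply: eq_bigr => j _; rewrite linearZ /= pe; congr (_ *: _).
  by case: eqP.
- rewrite comp_lfunE iE linear_sum zero_lfunE big1 // => j _.
  rewrite linearZ /= pe; case: (k =P l) => [E|_]; last by rewrite scaler0.
  by rewrite E eqxx in kl.
- rewrite sum_lfunE id_lfunE [RHS]exE; apply: eq_bigr => k _.
  rewrite comp_lfunE iE pE; apply: eq_bigr => j _.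
  by rewrite coord_sum_free // (basis_free (vbasisP _)).
Qed.

Lemma vect_abelian : abelian_category vectLinear.
Proof.
split=> [n S|V W f|V W f|V W f mf|V W f ef]; first exact: vect_direct_sum.
- have [k [k0 kf]] := vect_inclusion (lker f).
  by exists (subvs_of (lker f) : vectType K), k; apply: vect_is_kernel.
- have [X [q [q1 qf]]] := vect_quotient (limg f).
  by exists X, q; apply: vect_is_cokernel.
- have [X [q [_ qf]]] := vect_quotient (limg f).
  by exists X, q; apply: vect_is_kernel; first exact: vect_mono.
- have [k [_ kf]] := vect_inclusion (lker f).
  by exists (subvs_of (lker f) : vectType K), k; apply: vect_is_cokernel;
     first exact: vect_epi.
Qed.

Definition vline_map V (v : V) : 'Hom(K^o, V) := linfun (fun k : K^o => k *: v).

Lemma vline_mapE V (v : V) (k : K^o) : vline_map v k = k *: v.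
Proof. by rewrite linfunE // => a b c; rewrite scalerDl scalerA. Qed.

Lemma vect_iso V W (f : 'Hom(V, W)) :
  lker f = 0%VS -> limg f = fullv -> @is_iso K vectLinear _ _ f.
Proof.
move=> k0 i1; apply: (@vect_isoI _ _ _ f^-1%VF).
  by rewrite lker0_compVf ?k0.
by apply/lfunP => w; rewrite comp_lfunE id_lfunE limg_lfunVK // i1 memvf.
Qed.

Lemma vect_zero V : @is_zero K vectLinear V <-> (forall v : V, v = 0).
Proof.
split=> [V0 v|V0]; last by apply/lfunP => v; rewrite [LHS]V0 [RHS]V0.
by rewrite -[LHS]id_lfunE [\1%VF]V0 zero_lfunE.
Qed.

Lemma vect_line_simple : @simple K vectLinear (K^o : vectType K).
Proof.
split=> [/vect_zero/(_ 1)/eqP|V f /vect_mono f0]; first by rewrite oner_eq0.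
have [V0|[v v0]] : (forall v : V, v = 0) \/ exists v : V, v != 0.
  case: (pselect (exists v : V, v != 0)) => [|nV]; [by right|left=> v].
  by apply/eqP/negP => /negP v0; apply: nV; exists v.
  by left; apply/vect_zero.
right; apply: vect_iso => //; apply/eqP; rewrite eqEsubv subvf.
have fv0 : f v != 0.
  by rewrite -memv_ker f0 memv0.
apply/subvP => k _; apply/memv_imgP; exists ((k / f v) *: v); first exact: memvf.
by rewrite linearZ /= /GRing.scale /= divfK.
Qed.

Lemma vect_simple V : @simple K vectLinear V ->
  @isomorphic K vectLinear V (K^o : vectType K).
Proof.
move=> [nV0 sV].
have [v v0] : exists v : V, v != 0.
  apply: contrapT => nV; apply: nV0; apply/vect_zero => v.
  by apply/eqP/negP => /negP v0; apply: nV; exists v.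
have ml : @is_mono K vectLinear _ _ (vline_map v).
  move=> X g h /lfunP gh; apply/lfunP => x; have := gh x.
  rewrite /= !comp_lfunE !vline_mapE => /eqP.
  by rewrite -subr_eq0 -scalerBl scaler_eq0 (negbTE v0) orbF subr_eq0 => /eqP.
case: (sV _ _ ml) => [/vect_zero z|[g [gf fg]]].
  by have /eqP := z (1 : K^o); rewrite oner_eq0.
by exists g, (vline_map v).
Qed.

Lemma vect_semisimple : semisimple_category vectLinear.
Proof.
move=> V; exists (\dim {:(V : vectType K)}), (fun _ => (K^o : vectType K)).
split=> [_|]; first exact: vect_line_simple.
exists (fun k => vline_map (vbasis {:(V : vectType K)})`_k), (@vcoord V).
split=> [k|k l kl|] /=; apply/lfunP => v.
- rewrite comp_lfunE vline_mapE vcoordE linearZ /= id_lfunE.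
  by rewrite coord_free ?(basis_free (vbasisP _)) // eqxx /GRing.scale /= mulr1.
- rewrite comp_lfunE vline_mapE vcoordE linearZ /= zero_lfunE.
  rewrite coord_free ?(basis_free (vbasisP _)) // eq_sym (negbTE kl).
  by rewrite mulr0.
- rewrite sum_lfunE id_lfunE [RHS](coord_vbasis (memvf v)).
  by apply: eq_bigr => k _; rewrite comp_lfunE vline_mapE vcoordE.
Qed.

Definition Vect : ribbonFusionCategory K.
Proof.
apply: (@RibbonFusionCategory K vectRibbon vect_abelian vect_semisimple
  vect_line_simple unit (fun _ => (K^o : vectType K))) => [_|[] []|V sV] //.
- exact: vect_line_simple.
- by exists tt; apply: vect_simple.
Defined.

End Vect.

Section Smooth.
Variable R : realType.

(* [C^k] on an open set of a finite-dimensional space *)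
Fixpoint Ck_on (V W : normedModType R) (k : nat) (U : set V) (f : V -> W)
    : Prop :=
  if k is k'.+1 then
    (forall x, U x -> differentiable f x) /\
    (forall v, Ck_on k' U (fun x => 'D_v f x))
  else forall x, U x -> {for x, continuous f}.

Definition smooth_on (V W : normedModType R) (U : set V) (f : V -> W) :=
  forall k, Ck_on k U f.

(* The charts [phi c], with inverses [psi c], form an oriented smooth atlas;
   [phi c] and [psi c] are irrelevant outside [dom c] and its image. *)
Record closedOrientedSmooth4Manifold := ClosedOrientedSmooth4Manifold {
  carrier :> topologicalType;
  carrier_hausdorff : hausdorff_space carrier;
  carrier_compact : compact [set: carrier];
  chart : Type;
  dom : chart -> set carrier;
  phi : chart -> carrier -> 'rV[R]_4;
  psi : chart -> 'rV[R]_4 -> carrier;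
  dom_open : forall c, open (dom c);
  dom_cover : forall x, exists c, dom c x;
  phi_open : forall c, open (phi c @` dom c);
  phiK : forall c x, dom c x -> psi c (phi c x) = x;
  phi_continuous : forall c x, dom c x -> {for x, continuous (phi c)};
  psi_continuous : forall c y, (phi c @` dom c) y -> {for y, continuous (psi c)};
  transition_smooth : forall c c',
    smooth_on (phi c @` (dom c `&` dom c')) (phi c' \o psi c);
  transition_oriented : forall c c' y, (phi c @` (dom c `&` dom c')) y ->
    0 < \det (jacobian (phi c' \o psi c) y) }.

End Smooth.

(* A complex on the vertices [0 < ... < n-1] is the set of its (nonempty)
   simplices; every element of ['I_n] is a vertex. *)
Definition is_complex n (T : {set {set 'I_n}}) :=
  [/\ finset.set0 \notin T, forall v, [set v]%SET \in T
    & forall s t : {set 'I_n}, s \in T -> t \subset s -> t != finset.set0 -> t \in T].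

(* the [k]-simplices, as increasing lists of [k + 1] vertices *)
Definition simplex n (T : {set {set 'I_n}}) (k : nat) :=
  {s : k.+1.-tuple 'I_n | sorted ltn (map val s) && ([set:: s] \in T)}.

Definition vtx n (T : {set {set 'I_n}}) k (s : simplex T k) (i : nat) : 'I_n :=
  nth (thead (val s)) (val s) i.

Definition is_facet n (T : {set {set 'I_n}}) k (s : simplex T k.+1) (i : nat)
    (t : simplex T k) : bool :=
  val t == take i (val s) ++ drop i.+1 (val s) :> seq 'I_n.

Section Triangulation.
Variable R : realType.

Definition support n (x : 'rV[R]_n) : {set 'I_n} := finset (fun i => x 0 i != 0).

(* geometric realization, in barycentric coordinates *)
Definition realization n (T : {set {set 'I_n}}) : set 'rV[R]_n :=
  [set x : 'rV[R]_n |
    [/\ forall i, 0 <= x 0 i, \sum_i x 0 i = 1 & support x \in T]].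

(* [J] subdivides [T], vertex [w] of [J] being placed at the point [row w P] *)
Definition is_subdivision m n (J : {set {set 'I_m}}) (T : {set {set 'I_n}})
    (P : 'M[R]_(m, n)) :=
  [/\ is_complex J,
      set_bij (realization J) (realization T) (fun y => y *m P)
    & forall s, s \in J -> exists2 t, t \in T &
        forall w, w \in s -> support (row w P) \subset t].

Variable M : closedOrientedSmooth4Manifold R.

(* On every 4-simplex [s] of the subdivision lying in a 4-simplex [sg] of [T],
   [h] is, in charts, the restriction of a smooth map whose differential is an
   isomorphism on the tangent space of [sg]; it maps the frame
   [v1 - v0, ..., v4 - v0] given by the vertex order of [sg] to a positive frame
   exactly when [eps sg] holds. *)
Definition piecewise_smooth_oriented m n (J : {set {set 'I_m}})
    (T : {set {set 'I_n}}) (P : 'M[R]_(m, n)) (h : 'rV[R]_n -> M)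
    (eps : simplex T 4 -> bool) :=
  forall (sg : simplex T 4) (s : {set 'I_m}), s \in J -> #|s| = 5%N ->
    (forall w, w \in s -> support (row w P) \subset [set:: val sg]) ->
  forall y, realization J y -> support y \subset s ->
  forall c : chart M, dom c (h (y *m P)) ->
  exists (O : set 'rV[R]_n) (F : 'rV[R]_n -> 'rV[R]_4),
    [/\ open O, O (y *m P), smooth_on O F,
        forall z, realization J z -> support z \subset s -> O (z *m P) ->
          F (z *m P) = phi c (h (z *m P))
      & 0 < (if eps sg then 1 else -1) *
          \det (\matrix_(k < 4) 'd F (y *m P)
                  (delta_mx 0 (vtx sg k.+1) - delta_mx 0 (vtx sg 0)))].

(* [tri_signs sg] holds when the orientation of [sg] given by the vertex order
   is that of [M].  [tri_pure] and [tri_cycle] are the usual properties of a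
   triangulation of a closed oriented manifold: every simplex is a face of a
   4-simplex, and every 3-simplex receives each of its two orientations from
   exactly one 4-simplex. *)
Record orderedTriangulation := OrderedTriangulation {
  nvert : nat;
  tri :> {set {set 'I_nvert}};
  tri_complex : is_complex tri;
  tri_map : 'rV[R]_nvert -> M;
  tri_continuous : {within realization tri, continuous tri_map};
  tri_bij : set_bij (realization tri) [set: M] tri_map;
  tri_signs : simplex tri 4 -> bool;
  tri_smooth : exists m (J : {set {set 'I_m}}) (P : 'M[R]_(m, nvert)),
    is_subdivision J tri P /\
    piecewise_smooth_oriented J P tri_map tri_signs;
  tri_pure : forall s, s \in tri ->
    exists2 t : {set 'I_nvert}, t \in tri & (s \subset t) && (#|t| == 5%N);
  tri_cycle : forall (t : simplex tri 3) (b : bool),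
    #|[pred u : simplex tri 4 * 'I_5 |
        is_facet u.1 u.2 t && (tri_signs u.1 (+) odd u.2 == b)]| = 1%N }.

End Triangulation.

Section Local.
Variables (K : fieldType) (C : ribbonCategory K).
(* the objects [f i j k] colouring the 2-simplices *)
Variables (I : Type) (f : I -> I -> I -> C).

Definition Vpos (i j k l : I) : vectType K :=
  mor (f i k l \ot f i j k) (f i j l \ot f j k l).

Definition Vneg (i j k l : I) : vectType K :=
  mor (f i j l \ot f j k l) (f i k l \ot f i j k).

Section Cell.
Variables i0 i1 i2 i3 i4 : I.

Definition Ztilde_pos (x0 : Vpos i0 i2 i3 i4) (x1 : Vpos i0 i1 i2 i4)
    (x2 : Vneg i1 i2 i3 i4) (x3 : Vneg i0 i1 i3 i4) (x4 : Vneg i0 i1 i2 i3)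
    : K :=
  Tr (associ (f i0 i3 i4) (f i0 i2 i3) (f i0 i1 i2)
      \oc (idm (f i0 i3 i4) \om x4)
      \oc assoc (f i0 i3 i4) (f i0 i1 i3) (f i1 i2 i3)
      \oc (x3 \om idm (f i1 i2 i3))
      \oc associ (f i0 i1 i4) (f i1 i3 i4) (f i1 i2 i3)
      \oc (idm (f i0 i1 i4) \om x2)
      \oc assoc (f i0 i1 i4) (f i1 i2 i4) (f i2 i3 i4)
      \oc (x1 \om idm (f i2 i3 i4))
      \oc associ (f i0 i2 i4) (f i0 i1 i2) (f i2 i3 i4)
      \oc (idm (f i0 i2 i4) \om braid (f i2 i3 i4) (f i0 i1 i2))
      \oc assoc (f i0 i2 i4) (f i2 i3 i4) (f i0 i1 i2)
      \oc (x0 \om idm (f i0 i1 i2))).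

Definition Ztilde_neg (x0 : Vneg i0 i2 i3 i4) (x1 : Vneg i0 i1 i2 i4)
    (x2 : Vpos i1 i2 i3 i4) (x3 : Vpos i0 i1 i3 i4) (x4 : Vpos i0 i1 i2 i3)
    : K :=
  Tr ((x0 \om idm (f i0 i1 i2))
      \oc associ (f i0 i2 i4) (f i2 i3 i4) (f i0 i1 i2)
      \oc (idm (f i0 i2 i4) \om braidi (f i2 i3 i4) (f i0 i1 i2))
      \oc assoc (f i0 i2 i4) (f i0 i1 i2) (f i2 i3 i4)
      \oc (x1 \om idm (f i2 i3 i4))
      \oc associ (f i0 i1 i4) (f i1 i2 i4) (f i2 i3 i4)
      \oc (idm (f i0 i1 i4) \om x2)
      \oc assoc (f i0 i1 i4) (f i1 i3 i4) (f i1 i2 i3)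
      \oc (x3 \om idm (f i1 i2 i3))
      \oc associ (f i0 i3 i4) (f i0 i1 i3) (f i1 i2 i3)
      \oc (idm (f i0 i3 i4) \om x4)
      \oc assoc (f i0 i3 i4) (f i0 i2 i3) (f i0 i1 i2)).

Definition Vtwo : vectType K := tens (Vpos i0 i2 i3 i4) (Vpos i0 i1 i2 i4).

Definition Vthree : vectType K :=
  tens (tens (Vpos i1 i2 i3 i4) (Vpos i0 i1 i3 i4)) (Vpos i0 i1 i2 i3).

Definition tens2 (V W : vectType K) (a : V -> K) (b : W -> K)
    (t : tens V W) : K :=
  tlift (fun v w => a v * b w : K^o) t.

(* the unique map with the stated pairings, the pairings being nondegenerate *)
Definition Zpos : 'Hom(Vtwo, Vthree) :=
  xget 0 [set Z : 'Hom(Vtwo, Vthree) |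
    forall (x0 : Vpos i0 i2 i3 i4) (x1 : Vpos i0 i1 i2 i4)
      (x2 : Vneg i1 i2 i3 i4) (x3 : Vneg i0 i1 i3 i4) (x4 : Vneg i0 i1 i2 i3),
      tens2 (tens2 (fun v => pairing v x2) (fun v => pairing v x3))
        (fun v => pairing v x4) (Z (pure x0 x1))
      = Ztilde_pos x0 x1 x2 x3 x4].

Definition Zneg : 'Hom(Vthree, Vtwo) :=
  xget 0 [set Z : 'Hom(Vthree, Vtwo) |
    forall (x0 : Vneg i0 i2 i3 i4) (x1 : Vneg i0 i1 i2 i4)
      (x2 : Vpos i1 i2 i3 i4) (x3 : Vpos i0 i1 i3 i4) (x4 : Vpos i0 i1 i2 i3),
      tens2 (fun v => pairing x0 v) (fun v => pairing x1 v)
        (Z (pure (pure x2 x3) x4))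
      = Ztilde_neg x0 x1 x2 x3 x4].

Definition basis2 (k0 k1 : nat) : Vtwo := pure (basis_vec _ k0) (basis_vec _ k1).

Definition basis3 (k2 k3 k4 : nat) : Vthree :=
  pure (pure (basis_vec _ k2) (basis_vec _ k3)) (basis_vec _ k4).

Definition coord2 (k0 k1 : nat) : Vtwo -> K :=
  tens2 (basis_coord k0) (basis_coord k1).

Definition coord3 (k2 k3 k4 : nat) : Vthree -> K :=
  tens2 (tens2 (basis_coord k2) (basis_coord k3)) (basis_coord k4).

End Cell.
End Local.

Section Invariants.
Variable R : realType.
Local Notation CC := R[i].
Variables (M : closedOrientedSmooth4Manifold R) (T : orderedTriangulation M).

Section Trace.
Variable C : ribbonFusionCategory CC.
Variable f : {ffun simplex T 2 -> irr C}.

(* the representative of the colour of a 2-simplex; the unit object is a dummy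
   value for triples that are not 2-simplices *)
Definition fobj (i j k : 'I_(nvert T)) : C :=
  if insub [tuple i; j; k] is Some b then rep (f b) else tunit.

(* the indices of the tensor product basis of the tensor product of the spaces
   [V^+(t)] over all 3-simplices [t] *)
Definition multi_index : finType :=
  {dffun forall t : simplex T 3,
     'I_(\dim {:Vpos fobj (vtx t 0) (vtx t 1) (vtx t 2) (vtx t 3)})}.

Definition index_at (b : multi_index) (i j k l : 'I_(nvert T)) : nat :=
  if insub [tuple i; j; k; l] is Some t then b t else 0%N.

(* the matrix entry of the map [w *: Z^eps(sg)], from the basis vector given by
   [b] on the source facets of [sg] to the one given by [b'] on the target
   facets *)
Definition cell_entry (w : CC) (sg : simplex T 4) (b' b : multi_index) : CC :=
  let i0 := vtx sg 0 in let i1 := vtx sg 1 in let i2 := vtx sg 2 in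
  let i3 := vtx sg 3 in let i4 := vtx sg 4 in
  if tri_signs sg then
    coord3 (index_at b' i1 i2 i3 i4) (index_at b' i0 i1 i3 i4)
           (index_at b' i0 i1 i2 i3)
      ((w *: Zpos fobj i0 i1 i2 i3 i4)
         (basis2 _ _ _ _ _ _ (index_at b i0 i2 i3 i4) (index_at b i0 i1 i2 i4)))
  else
    coord2 (index_at b' i0 i2 i3 i4) (index_at b' i0 i1 i2 i4)
      ((w *: Zneg fobj i0 i1 i2 i3 i4)
         (basis3 _ _ _ _ _ _ (index_at b i1 i2 i3 i4) (index_at b i0 i1 i3 i4)
            (index_at b i0 i1 i2 i3))).

(* the matrix of the endomorphism [\bigotimes_sg w sg *: Z^eps(sg)]: by
   [tri_cycle], every 3-simplex is a source facet of exactly one 4-simplex and a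
   target facet of exactly one 4-simplex *)
Definition tensor_entry (w : simplex T 4 -> CC) (b' b : multi_index) : CC :=
  \prod_(sg : simplex T 4) cell_entry (w sg) sg b' b.

Definition tensor_trace (w : simplex T 4 -> CC) : CC :=
  \sum_(b : multi_index) tensor_entry w b b.

End Trace.

Definition CraneYetter (C : ribbonFusionCategory CC) : CC :=
  \sum_(f : {ffun simplex T 2 -> irr C})
     globalDim2 C ^ (#|{: simplex T 0}|%:Z - #|{: simplex T 1}|%:Z)
     * (\prod_(b : simplex T 2) qdim (rep (f b)))
     * tensor_trace f (fun _ => 1).

Section Group.
Variable G : finGroupType.

(* 4-cocycles on [G] with values in [U(1)] (trivial action) *)
Definition is_U1_cocycle4 (w : G -> G -> G -> G -> CC) :=
  (forall a b c d, `|w a b c d| = 1) /\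
  (forall a b c d e,
    w b c d e * (w (a * b)%g c d e)^-1 * w a (b * c)%g d e
    * (w a b (c * d)%g e)^-1 * w a b c (d * e)%g * (w a b c d)^-1 = 1).

Variable g : {ffun simplex T 1 -> G}.

Definition gval (i j : 'I_(nvert T)) : G :=
  if insub [tuple i; j] is Some e then g e else 1%g.

Definition holonomy (b : simplex T 2) : G :=
  let i0 := vtx b 0 in let i1 := vtx b 1 in let i2 := vtx b 2 in
  ((gval i0 i2)^-1 * gval i0 i1 * gval i1 i2)%g.

Definition flat : bool :=
  [forall b : simplex T 2, gval (vtx b 0) (vtx b 2) ==
     (gval (vtx b 0) (vtx b 1) * gval (vtx b 1) (vtx b 2))%g].

Definition cell_weight (w : G -> G -> G -> G -> CC) (sg : simplex T 4) : CC :=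
  let x := w (gval (vtx sg 0) (vtx sg 1)) (gval (vtx sg 1) (vtx sg 2))
             (gval (vtx sg 2) (vtx sg 3)) (gval (vtx sg 3) (vtx sg 4)) in
  if tri_signs sg then x else x^-1.

End Group.

Definition DijkgraafWitten (G : finGroupType) (w : G -> G -> G -> G -> CC) : CC :=
  #|G|%:R ^- #|{: simplex T 0}| *
  \sum_(g : {ffun simplex T 1 -> G} | flat g)
     \prod_(sg : simplex T 4) cell_weight g w sg.

(* the [h]-sector of the trivially [G]-graded category: all objects for the
   neutral element, only zero objects otherwise *)
Definition trivial_sector (G : finGroupType) (C : ribbonFusionCategory CC)
    (h : G) (X : C) : Prop :=
  h != 1%g -> is_zero X.

Definition is_coloring (G : finGroupType) (C : ribbonFusionCategory CC)
    (F : {ffun simplex T 1 -> G} * {ffun simplex T 2 -> irr C}) : bool :=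
  [forall b : simplex T 2,
     `[< trivial_sector (holonomy F.1 b) (rep (F.2 b)) >]].

Definition twistedPartition (G : finGroupType) (C : ribbonFusionCategory CC)
    (w : G -> G -> G -> G -> CC) : CC :=
  \sum_(F : {ffun simplex T 1 -> G} * {ffun simplex T 2 -> irr C}
        | is_coloring F)
     (globalDim2 C / #|G|%:R) ^+ #|{: simplex T 0}|
     * (\prod_(b : simplex T 2) qdim (rep (F.2 b)))
     * tensor_trace F.2 (cell_weight F.1 w)
     / globalDim2 C ^+ #|{: simplex T 1}|.

End Invariants.

Arguments Vect {K}.

(* Main.v *)
Require Import Defs.
From mathcomp Require Import all_boot all_order all_fingroup all_algebra.
From mathcomp Require Import reals complex.
From mathcomp Require Import boolp zify ring.
From mathcomp Require classical_sets.

(* Simple objects are nonzero, so a colouring of the trivially graded category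
   is exactly a flat [g] together with an arbitrary [f], and the weights [omega]
   pull out of the trace; the sum over colourings then factors.  The powers of
   [D^2] also match when [D^2 = 0], because a nonempty triangulation has more
   edges than vertices.

   For [Vect] all the spaces [V^+] are one-dimensional.  If [e = c *: id] is the
   basis vector used, a positive 4-simplex contributes [c^-1] and a negative one
   contributes [c]; there are equally many of both because every 3-simplex is
   a face of two 4-simplices inducing opposite orientations on it.  Hence the
   Crane-Yetter invariant is [1]. *)

Set Implicit Arguments.
Unset Strict Implicit.
Unset Printing Implicit Defensive.

Import Order.TTheory GRing.Theory Num.Theory.
Local Open Scope ring_scope.

(* Over a field [0] to a negative power is [0], so [x = 0] only has to be
   excluded when the two exponents agree. *)
Lemma expr_divr_exprz (F : fieldType) (x : F) (a b : nat) :
  (a = 0 -> b = 0)%N -> (0 < a -> a != b)%N ->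
  x ^+ a / x ^+ b = x ^ (a%:Z - b%:Z).
Proof.
move=> ab0 ab; have [->|x0] := eqVneq x 0; last first.
  by rewrite expfzDr // -exprnP exprnN.
case: a ab0 ab => [|a] ab0 ab; first by rewrite ab0 // !expr0 divr1.
by rewrite exp0rz subr_eq0 eqz_nat (negPf (ab isT)) expr0n mul0r.
Qed.

(** * Products of functionals on tensor products *)

Section FunctionalTensor.
Variable K : fieldType.
Implicit Types V W U : vectType K.

Lemma tens2_pure V W (a : V -> K^o) (b : W -> K^o) v w :
  linear a -> linear b -> tens2 a b (pure v w) = a v * b w.
Proof.
move=> la lb; rewrite /tens2 tlift_pure //; split=> [y k x z|x k y z].
  by rewrite la mulrDl /GRing.scale /= mulrA.
by rewrite lb mulrDr /GRing.scale /= mulrCA.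
Qed.

(** On one-dimensional spaces, pairings and basis coordinates are multiples of one fixed functional;
    this lemma pulls the factors out of [tens2]. *)
Lemma tens2_scale V W (a a' : V -> K) (b b' : W -> K) k l t :
  (forall v, a v = k * a' v) -> (forall w, b w = l * b' w) ->
  tens2 a b t = k * l * tens2 a' b' t.
Proof.
move=> aE bE; rewrite /tens2 !tliftE mulr_sumr; apply: eq_bigr => i _.
rewrite mulr_sumr; apply: eq_bigr => j _.
by rewrite aE bE /GRing.scale /=; ring.
Qed.

Lemma tens2_linear V W (a : V -> K) (b : W -> K) :
  linear (tens2 a b : _ -> K^o).
Proof. by move=> k x y; rewrite /tens2 linearP. Qed.

Lemma tens2Z V W (a : V -> K) (b : W -> K) k t :
  tens2 a b (k *: t) = k * tens2 a b t.
Proof. by rewrite /tens2 linearZ. Qed.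

Lemma mul_bilin V W U (a : V -> K^o) (b : W -> K^o) (x : U) :
  linear a -> linear b -> bilin (fun v w => (a v * b w : K) *: x).
Proof.
move=> la lb; split=> [w k v v'|v k w w'].
  by rewrite la mulrDl scalerDl scalerA /GRing.scale /= mulrA.
by rewrite lb mulrDr scalerDl scalerA /GRing.scale /= mulrCA.
Qed.

End FunctionalTensor.

(** * Colourings and cocycle weights *)

Section Weights.
Variables (R : realType) (M : closedOrientedSmooth4Manifold R).
Variables (T : orderedTriangulation M) (C : ribbonFusionCategory R[i]).
Local Notation CC := R[i].

Lemma cell_entry_scale (f : {ffun simplex T 2 -> irr C}) (k : CC) sg b' b :
  cell_entry (f := f) k sg b' b = k * cell_entry (f := f) 1 sg b' b.
Proof.
rewrite /cell_entry; case: (tri_signs sg).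
  by rewrite /coord3 !scale_lfunE !tens2Z mul1r.
by rewrite /coord2 !scale_lfunE !tens2Z mul1r.
Qed.

Lemma tensor_trace_weights (f : {ffun simplex T 2 -> irr C}) w :
  tensor_trace f w =
  (\prod_(sg : simplex T 4) w sg) * tensor_trace f (fun _ => 1).
Proof.
rewrite /tensor_trace mulr_sumr; apply: eq_bigr => b _.
by rewrite -big_split; apply: eq_bigr => sg _; rewrite /= cell_entry_scale.
Qed.

Lemma is_coloringE (G : finGroupType)
    (F : {ffun simplex T 1 -> G} * {ffun simplex T 2 -> irr C}) :
  is_coloring F = flat F.1.
Proof.
apply: eq_forallb => b; apply/asboolP/eqP => [hb|hb h1]; last first.
  by rewrite /holonomy hb -mulgA mulVg eqxx in h1.
apply/eqP; rewrite eq_mulVg1 mulgA; apply/negPn/negP => h1.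
by have [nz _] := rep_simple (F.2 b); apply/nz/hb.
Qed.

End Weights.

(** * Counting simplices and signs *)

Section Counting.
Variables (R : realType) (M : closedOrientedSmooth4Manifold R).
Variable T : orderedTriangulation M.

Lemma card_vertices : #|{: simplex T 0}| = nvert T.
Proof.
have [_ T1 _] := tri_complex T.
have vP (v : 'I_(nvert T)) : sorted ltn (map val [tuple v])
    && ([set:: [tuple v]]%SET \in (T : {set {set 'I_(nvert T)}})).
  suff -> : [set:: [tuple v]]%SET = [set v]%SET by exact: T1.
  by apply/setP => x; rewrite !inE.
pose F v : simplex T 0 := Sub [tuple v] (vP v).
rewrite -[RHS]card_ord -(@card_codom _ _ F); last first.
  by move=> v w /(congr1 val)/= [].
apply/esym/eq_card => s; rewrite [RHS]inE; apply/codomP.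
exists (thead (val s)); apply/val_inj/eq_from_tnth => i.
by rewrite (ord1 i).
Qed.

(** [adj v v] holds as well, hence the conditions [v < w] and [v != w] in the sums below. *)
Let adj (v w : 'I_(nvert T)) : bool :=
  [set v; w]%SET \in (T : {set {set 'I_(nvert T)}}).

Lemma card_edges :
  #|{: simplex T 1}| = (\sum_(v < nvert T) \sum_(w < nvert T | v < w) adj v w)%N.
Proof.
pose E := [pred u : 'I_(nvert T) * 'I_(nvert T) | (u.1 < u.2)%N && adj u.1 u.2].
transitivity #|E|; last first.
  rewrite pair_big_dep /= -sum1_card big_mkcondr /=; apply: eq_bigr => u _.
  by case: (adj _ _).
pose F (s : simplex T 1) := (tnth (val s) ord0, tnth (val s) (lift ord0 ord0)).
have Finj : injective F.
  move=> s t [e0 e1]; apply/val_inj/eq_from_tnth => i.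
  by case: (unliftP ord0 i) => [j|] -> //; rewrite (ord1 j).
rewrite -(card_codom Finj); apply: eq_card => -[v w]; apply/codomP/idP => /=.
  case=> -[[[|a [|b [|]]] //= sz] /= /andP[/= lt sT]] [-> ->].
  rewrite !(tnth_nth v) /= in lt *; rewrite inE /= /adj.
  rewrite andbT in lt; rewrite lt /=.
  suff -> : [set a; b]%SET = [set:: [:: a; b]]%SET by [].
  by apply/setP => x; rewrite !inE.
rewrite inE /= => /andP[vw avw].
have P : sorted ltn (map val [tuple v; w])
    && ([set:: [tuple v; w]]%SET \in (T : {set {set 'I_(nvert T)}})).
  rewrite /= vw /=.
  suff -> : [set:: [tuple v; w]]%SET = [set v; w]%SET by [].
  by apply/setP => x; rewrite !inE.
by exists (Sub [tuple v; w] P); rewrite /F /=.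
Qed.

(** By purity [v] lies in a 4-simplex, whose four other vertices are all joined to [v]. *)
Lemma degree_ge4 (v : 'I_(nvert T)) :
  (4 <= \sum_(w < nvert T | v != w) adj v w)%N.
Proof.
have [_ T1 Tsub] := tri_complex T.
have [t tT /andP[vt /eqP t5]] := tri_pure (T1 v).
rewrite sub1set in vt.
have <- : #|t :\ v| = 4%N by move: (cardsD1 v t); rewrite vt t5 => -[].
rewrite -sum1_card [leqRHS]big_mkcond [leqLHS]big_mkcond.
apply: leq_sum => w _; rewrite !inE eq_sym; case: eqP => //= _.
case: ifP => // wt; rewrite /adj (Tsub t) //; last first.
  by apply/set0Pn; exists v; rewrite !inE eqxx.
by apply/subsetP => x; rewrite !inE => /orP[]/eqP->.
Qed.

Lemma edges_ge_double_vertices : (4 * nvert T <= 2 * #|{: simplex T 1}|)%N.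
Proof.
have adjC v w : adj v w = adj w v by rewrite /adj setUC.
(* Handshake argument: of the two copies of the edge sum, the second has [v] and [w] exchanged, so
   that together they run over all [w != v] and give the degree of [v]. *)
rewrite mulnC mul2n -addnn {1}card_edges card_edges.
under [X in (_ <= _ + X)%N]eq_bigr do rewrite big_mkcond.
rewrite [X in (_ <= _ + X)%N]exchange_big -big_split /=.
rewrite -[X in (X * _)%N]card_ord -sum_nat_const; apply: leq_sum => v _.
apply: leq_trans (degree_ge4 v) _.
rewrite big_mkcond [X in (_ <= X + _)%N]big_mkcond -big_split.
apply: leq_sum => w _ /=; rewrite -val_eqE /= (adjC w).
by case: ltngtP => //= _; rewrite ?addn0 ?add0n.
Qed.

(** Deleting entry [i] leaves an increasing list of four vertices, and its vertex set lies in the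
    complex by closure under nonempty subsets. *)
Lemma facet_unique (sg : simplex T 4) (i : 'I_5) :
  #|[pred t : simplex T 3 | is_facet sg i t]| = 1%N.
Proof.
have [_ _ Tsub] := tri_complex T.
case: sg => s /= sP; have /andP[ss sT] := sP.
pose r := take i s ++ drop i.+1 s.
have sz : size r == 4%N.
  rewrite /r size_cat size_take size_drop size_tuple ltn_ord.
  by case: i {r} => -[|[|[|[|[|]]]]].
have sub : subseq r s.
  rewrite /r -[X in subseq _ X](cat_take_drop i) cat_subseq //.
  by rewrite -addn1 addnC -drop_drop drop_subseq.
have rP : sorted ltn (map val (Tuple sz))
    && ([set:: Tuple sz]%SET \in (T : {set {set 'I_(nvert T)}})).
  apply/andP; split.
    exact: (subseq_sorted ltn_trans (map_subseq val sub) ss).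
  apply: Tsub sT _ _.
    by apply/subsetP => x; rewrite !inE => /(mem_subseq sub).
  apply/set0Pn; exists (thead (Tuple sz)); rewrite inE.
  exact: mem_tnth.
pose r3 : simplex T 3 := Sub (Tuple sz) rP.
transitivity #|pred1 r3|; last by rewrite card1.
by apply: eq_card => t; rewrite !inE.
Qed.

(* A positive 4-simplex has 3 facets of one induced orientation and 2 of the
   other, a negative one the reverse, while both orientations occur equally
   often by [tri_cycle]. *)
Lemma card_signs :
  #|[pred sg | @tri_signs _ _ T sg]| = #|[pred sg | ~~ @tri_signs _ _ T sg]|.
Proof.
pose N b := (\sum_(sg : simplex T 4) \sum_(i < 5) (tri_signs sg (+) odd i == b))%N.
(* Double counting: a 4-simplex with an index determines one facet, and by [tri_cycle] each
   3-simplex arises from exactly one such pair of sign [b]. *)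
have NE b : N b = #|{: simplex T 3}|.
  rewrite -sum1_card /N pair_bigA /=.
  transitivity (\sum_(u : simplex T 4 * 'I_5) \sum_(t : simplex T 3)
      (is_facet u.1 u.2 t && (tri_signs u.1 (+) odd u.2 == b)) : nat)%N.
    apply: eq_bigr => u _; case: (_ == b); last first.
      by rewrite big1 // => t _; rewrite andbF.
    apply: etrans (esym (facet_unique u.1 u.2)) _; rewrite -sum1_card big_mkcond.
    by apply: eq_bigr => t _; rewrite inE andbT; case: is_facet.
  rewrite exchange_big; apply: eq_bigr => t _.
  apply: etrans (tri_cycle t b); rewrite -sum1_card [RHS]big_mkcond.
  by apply: eq_bigr => u _; rewrite inE; case: (_ && _).
have eN b : N b = (\sum_(sg : simplex T 4) (if tri_signs sg == b then 3 else 2))%N.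
  apply: eq_bigr => sg _; rewrite !big_ord_recl big_ord0 /=.
  by case: (tri_signs sg); case: b.
have := etrans (NE true) (esym (NE false)); rewrite !eN.
rewrite (bigID (fun sg => tri_signs sg)) [RHS](bigID (fun sg => tri_signs sg)) /=.
rewrite (eq_bigr (fun=> 3%N)); last by move=> sg ->.
rewrite [X in (_ + X)%N](eq_bigr (fun=> 2%N)); last by move=> sg /negPf->.
rewrite [in RHS](eq_bigr (fun=> 2%N)); last by move=> sg ->.
rewrite [X in (_ = _ + X)%N](eq_bigr (fun=> 3%N)); last by move=> sg /negPf->.
rewrite !sum_nat_const.
have cancel p q : (p * 3 + q * 2 = p * 2 + q * 3 -> p = q)%N by lia.
exact: cancel.
Qed.

End Counting.

(** * The spherical trace in [Vect] *)

Section VectTrace.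
Variable K : fieldType.

Lemma dim_tens (V W : vectType K) :
  \dim {:tens V W} = (\dim {:V} * \dim {:W})%N.
Proof. by rewrite dimvf. Qed.

Lemma dim_Hom (V W : vectType K) :
  \dim {:'Hom(V, W)} = (\dim {:V} * \dim {:W})%N.
Proof. by rewrite !dimvf. Qed.

Lemma dim_line : \dim {:(K^o : vectType K)} = 1%N.
Proof. by rewrite dimvf. Qed.

Lemma unit_scalar_vect (k : K) :
  unit_scalar (C := vectRibbon K) (k *: \1 : 'End(K^o))%VF = k.
Proof.
rewrite /unit_scalar linearZ /=.
have fr : free [tuple (\1 : 'End(K^o))%VF].
  rewrite free_cons /= span_nil memv0 nil_free andbT.
  apply/eqP => /(congr1 (fun h : 'End(K^o) => h 1)).
  by rewrite /= id_lfunE zero_lfunE => /eqP; rewrite oner_eq0.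
by rewrite (coord_free ord0 ord0 fr) mulr1.
Qed.

(** The twist is the identity and the braiding is the flip, so each basis vector in the coevaluation
    contributes [k]. *)
Lemma Tr_vect_scalar (V : vectType K) (k : K) :
  Tr (C := vectRibbon K) (X := V) (k *: \1 : 'End(V))%VF = k * (\dim {:V})%:R.
Proof.
rewrite /Tr -[RHS]unit_scalar_vect; congr unit_scalar.
apply/lfunP => x; rewrite /= !comp_lfunE tcoevE scale_lfunE id_lfunE.
rewrite !linearZ /= !linear_sum /=.
under eq_bigr => i _.
  rewrite tensmE tflipE tevE comp_lfunE !id_lfunE scale_lfunE id_lfunE.
  rewrite linearZ /= vcoordE coord_free ?(basis_free (vbasisP _)) // eqxx.
  rewrite [k *: _]mulr1.
  over.
rewrite sumr_const card_ord /GRing.scale /=.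
by rewrite [RHS]mulrC mulr_natr mulrnAr.
Qed.

End VectTrace.

(** * Alternating associators and scalars *)

Section ScalarComposites.
Variables (K : fieldType) (P Q : vectType K).
Variables (a : 'Hom(P, Q)) (b : 'Hom(Q, P)).
Hypothesis ba : (b \o a = \1)%VF.

(** This is the shape of the composite in [Ztilde_pos] once all morphisms are scalars and the
    braiding is trivial: [a] is the associator, [b] its inverse, and [P], [Q] are the two
    bracketings. *)
Lemma comp_scalars_pos (k0 k1 k2 k3 k4 : K) :
  (b \o (k4 *: \1) \o a \o (k3 *: \1) \o b \o (k2 *: \1) \o a
    \o (k1 *: \1) \o b \o a \o (k0 *: \1))%VF
  = (k0 * k1 * k2 * k3 * k4) *: \1%VF.
Proof.
apply/lfunP => v; rewrite !(comp_lfunE, scale_lfunE, id_lfunE).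
have baE x : b (a x) = x by rewrite -[LHS]comp_lfunE ba id_lfunE.
by rewrite !(linearZ, baE) /= !baE !scalerA; congr (_ *: _); ring.
Qed.

Lemma comp_scalars_neg (k0 k1 k2 k3 k4 : K) :
  ((k0 *: \1) \o b \o a \o (k1 *: \1) \o b \o (k2 *: \1) \o a
    \o (k3 *: \1) \o b \o (k4 *: \1) \o a)%VF
  = (k0 * k1 * k2 * k3 * k4) *: \1%VF.
Proof.
apply/lfunP => v; rewrite !(comp_lfunE, scale_lfunE, id_lfunE).
have baE x : b (a x) = x by rewrite -[LHS]comp_lfunE ba id_lfunE.
by rewrite !(linearZ, baE) /= !baE !scalerA; congr (_ *: _); ring.
Qed.

End ScalarComposites.

(** * 4-simplex maps when all colours are the line *)

Section VectCells.
Variables (K : fieldType) (I : Type).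
Local Notation L := (K^o : vectType K).
Local Notation X := (tens L L).
Local Notation u := (pure (1 : L) (1 : L)).

Lemma line_scale (k : L) : k = (k : K) *: (1 : L).
Proof. by rewrite /GRing.scale /= mulr1. Qed.

Lemma pure_line (k l : L) : pure k l = (k * l) *: u.
Proof.
rewrite {1}(line_scale k) {1}(line_scale l).
by rewrite (bilinZl (bilin_pure _ _)) (bilinZr (bilin_pure _ _)) scalerA.
Qed.

(** The scalar by which [x] acts: [X] is a line spanned by [u], and [tlunit] is the coordinate
    taking [u] to 1. *)
Definition end_scalar (x : 'End(X)) : K := tlunit L (x u).

Lemma end_scalar_linear : linear (end_scalar : 'End(X) -> K^o).
Proof.
move=> k x y; rewrite /end_scalar add_lfunE scale_lfunE.
by rewrite linearP.
Qed.

Lemma end_scalarE (x : 'End(X)) (v : X) : x v = end_scalar x *: v.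
Proof.
have E (t : X) : t = tlunit L t *: u.
  have /(congr1 (fun h : 'End(X) => h t)) :
      (vline_map u \o tlunit L)%VF = \1%VF.
    apply: tens_ext => k l.
    by rewrite comp_lfunE tlunitE vline_mapE id_lfunE [RHS]pure_line.
  by rewrite comp_lfunE vline_mapE id_lfunE.
rewrite {1}(E v) linearZ /= (E (x u)) scalerA mulrC -scalerA.
by rewrite -/(end_scalar x) -E.
Qed.

Lemma end_scalar1 : end_scalar \1%VF = 1.
Proof. by rewrite /end_scalar id_lfunE tlunitE /GRing.scale /= mulr1. Qed.

Lemma end_scalarK (x : 'End(X)) : x = end_scalar x *: \1%VF.
Proof. by apply/lfunP => v; rewrite end_scalarE scale_lfunE id_lfunE. Qed.

Lemma end_scalar_comp (x y : 'End(X)) :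
  end_scalar (x \o y)%VF = end_scalar x * end_scalar y.
Proof.
rewrite {1}/end_scalar comp_lfunE end_scalarE end_scalarE scalerA linearZ /=.
by rewrite tlunitE /GRing.scale /= !mulr1.
Qed.

Lemma dim_line2 : \dim {:X} = 1%N.
Proof. by rewrite dim_tens !dim_line. Qed.

Let f : I -> I -> I -> vectRibbon K := fun _ _ _ => L.

Lemma pairing_line (x y : 'End(X)) :
  pairing (C := vectRibbon K) (X := X) (Y := X) x y = end_scalar x * end_scalar y.
Proof.
rewrite /pairing /= [(_ \o _)%VF]end_scalarK Tr_vect_scalar dim_line2 mulr1.
exact: end_scalar_comp.
Qed.

Lemma tensm_end_line (x : 'End(X)) :
  tensm x (\1 : 'End(L))%VF = end_scalar x *: \1%VF.
Proof.
rewrite -tensm1 -(bilinZl (tensm_bilin _ _ _ _)).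
by congr tensm; exact: end_scalarK.
Qed.

Lemma tensm_line_end (x : 'End(X)) :
  tensm (\1 : 'End(L))%VF x = end_scalar x *: \1%VF.
Proof.
rewrite -tensm1 -(bilinZr (tensm_bilin _ _ _ _)).
by congr tensm; exact: end_scalarK.
Qed.

Lemma tflip_line : tflip L L = \1%VF.
Proof.
apply: tens_ext => k l.
by rewrite tflipE id_lfunE pure_line [RHS]pure_line mulrC.
Qed.

Lemma dim_end_line2 : \dim {:'End(X)} = 1%N.
Proof. by rewrite dim_Hom dim_line2. Qed.

(* the ratio of the library's basis vector of [End(X)], which is not explicit,
   to the identity *)
Definition basis_scalar : K := end_scalar (basis_vec 'End(X) 0).

Lemma basis_scalar_neq0 : basis_scalar != 0.
Proof.
apply/eqP => c0; have := basis_free (vbasisP {:'End(X)}).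
have e0 : basis_vec 'End(X) 0 = 0.
  by rewrite [LHS]end_scalarK -/basis_scalar c0 scale0r.
have : (0 : 'End(X)) \in vbasis {:'End(X)}.
  by rewrite -e0 mem_nth // size_tuple dim_end_line2.
by move=> /[swap] /free_not0 /[apply] /eqP.
Qed.

Lemma basis_coord_line (v : 'End(X)) :
  basis_coord 0 v = basis_scalar^-1 * end_scalar v.
Proof.
rewrite /basis_coord; case: insubP => [i _ iE|]; last by rewrite dim_end_line2.
have vE : v = (basis_scalar^-1 * end_scalar v) *: (vbasis {:'End(X)})`_i.
  rewrite iE -/(basis_vec 'End(X) 0) [basis_vec _ _]end_scalarK -/basis_scalar.
  by rewrite scalerA mulrAC mulVf ?basis_scalar_neq0 // mul1r -end_scalarK.
rewrite {1}vE linearZ /= coord_free ?(basis_free (vbasisP _)) // eqxx.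
exact: mulr1.
Qed.

Section Cell.
Variables i0 i1 i2 i3 i4 : I.

Lemma Ztilde_pos_line (x0 x1 x2 x3 x4 : 'End(X)) :
  Ztilde_pos (f := f) (i0 := i0) (i1 := i1) (i2 := i2) (i3 := i3) (i4 := i4)
    x0 x1 x2 x3 x4
  = end_scalar x0 * end_scalar x1 * end_scalar x2 * end_scalar x3 * end_scalar x4.
Proof.
rewrite /Ztilde_pos /= -[RHS]mulr1.
have <- : (\dim {:tens X L})%:R = 1 :> K by rewrite dim_tens dim_line2 dim_line.
rewrite -Tr_vect_scalar; congr Tr.
rewrite tflip_line tensm1 !tensm_end_line !tensm_line_end comp_lfun1r.
exact: (comp_scalars_pos (tassocK L L L)).
Qed.

Lemma Ztilde_neg_line (x0 x1 x2 x3 x4 : 'End(X)) :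
  Ztilde_neg (f := f) (i0 := i0) (i1 := i1) (i2 := i2) (i3 := i3) (i4 := i4)
    x0 x1 x2 x3 x4
  = end_scalar x0 * end_scalar x1 * end_scalar x2 * end_scalar x3 * end_scalar x4.
Proof.
rewrite /Ztilde_neg /= -[RHS]mulr1.
have <- : (\dim {:tens X L})%:R = 1 :> K by rewrite dim_tens dim_line2 dim_line.
rewrite -Tr_vect_scalar; congr Tr.
rewrite tflip_line tensm1 !tensm_end_line !tensm_line_end comp_lfun1r.
exact: (comp_scalars_neg (tassocK L L L)).
Qed.

(** [Zpos] is a chosen map, accessible only through its defining pairings. These are shown to be
    satisfiable, then tested on identities. *)
Lemma Zpos_spec (x0 x1 : 'End(X)) :
  tens2 (tens2 end_scalar end_scalar) end_scalar
    (Zpos f i0 i1 i2 i3 i4 (pure x0 x1)) = end_scalar x0 * end_scalar x1.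
Proof.
have sl := end_scalar_linear.
have pE (x y : 'End(X)) : pairing (C := vectRibbon K) (X := X) (Y := X) y x =
    end_scalar x * end_scalar y by rewrite pairing_line mulrC.
rewrite /Zpos; set P := (P in classical_sets.xget _ P).
have exP : exists Z, P Z.
  (* The target is a line spanned by the tensor product of three identities, so the prescribed
     pairings dictate this coefficient. *)
  exists (tlift (fun y0 y1 : 'End(X) => (end_scalar y0 * end_scalar y1) *:
     pure (pure (\1%VF : 'End(X)) (\1%VF : 'End(X))) (\1%VF : 'End(X)))).
  rewrite /P /= => y0 y1 y2 y3 y4; rewrite Ztilde_pos_line tlift_pure.
    rewrite (tens2_scale _ (fun t => tens2_scale t (pE y2) (pE y3)) (pE y4)).
    rewrite tens2Z !tens2_pure ?end_scalar1 //; last exact: tens2_linear.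
    by ring.
  by apply: mul_bilin.
have /= := @classical_sets.xgetPex _ 0 P exP.
rewrite /P /= => /(_ x0 x1 \1%VF \1%VF \1%VF).
rewrite Ztilde_pos_line end_scalar1 !mulr1 => <-.
rewrite (tens2_scale _ (fun t => tens2_scale t (pE _) (pE _)) (pE _)).
by rewrite end_scalar1 !mul1r.
Qed.

Lemma Zneg_spec (x2 x3 x4 : 'End(X)) :
  tens2 end_scalar end_scalar (Zneg f i0 i1 i2 i3 i4 (pure (pure x2 x3) x4))
  = end_scalar x2 * end_scalar x3 * end_scalar x4.
Proof.
have sl := end_scalar_linear; have pE := pairing_line.
rewrite /Zneg; set P := (P in classical_sets.xget _ P).
have exP : exists Z, P Z.
  (* Likewise here: [s3] multiplies the scalars of the three inputs. *)
  pose s3 := tens2 (tens2 end_scalar end_scalar) end_scalar.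
  exists (linfun (fun t => s3 t *: pure (\1%VF : 'End(X)) (\1%VF : 'End(X)))).
  rewrite /P /= => y0 y1 y2 y3 y4; rewrite Ztilde_neg_line linfunE; last first.
    by move=> k a b; rewrite /s3 tens2_linear scalerDl scalerA.
  rewrite (tens2_scale _ (pE y0) (pE y1)).
  rewrite tens2Z /s3 !tens2_pure ?end_scalar1 //; last exact: tens2_linear.
  by ring.
have /= := @classical_sets.xgetPex _ 0 P exP.
rewrite /P /= => /(_ \1%VF \1%VF x2 x3 x4).
rewrite Ztilde_neg_line end_scalar1 !mul1r => <-.
rewrite (tens2_scale _ (pE _) (pE _)).
by rewrite end_scalar1 !mul1r.
Qed.

(** With [c] the basis scalar, the two source vectors give [c ^ 2] and each of the three target
    coordinates gives [c^-1]. *)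
Lemma Zpos_entry :
  coord3 0 0 0 (Zpos f i0 i1 i2 i3 i4 (basis2 f i0 i1 i2 i3 i4 0 0))
  = basis_scalar^-1.
Proof.
have c0 := basis_scalar_neq0; rewrite /coord3.
pose bE := basis_coord_line.
rewrite (tens2_scale _ (fun t => tens2_scale t bE bE) bE).
rewrite [X in _ * X](Zpos_spec (basis_vec _ 0) (basis_vec _ 0)).
by rewrite -/basis_scalar; field.
Qed.

(** Now three source vectors and two target coordinates give [c ^ 3 * c ^ -2]. *)
Lemma Zneg_entry :
  coord2 0 0 (Zneg f i0 i1 i2 i3 i4 (basis3 f i0 i1 i2 i3 i4 0 0 0))
  = basis_scalar.
Proof.
have c0 := basis_scalar_neq0; rewrite /coord2.
rewrite (tens2_scale _ basis_coord_line basis_coord_line).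
pose e := basis_vec 'End(X) 0; rewrite [X in _ * X](Zneg_spec e e e).
by rewrite -/basis_scalar; field.
Qed.

End Cell.
End VectCells.

(** * The Crane-Yetter invariant of [Vect] *)

Section VectCraneYetter.
Variables (R : realType) (M : closedOrientedSmooth4Manifold R).
Variable T : orderedTriangulation M.
Local Notation CC := R[i].
Local Notation V := (Vect : ribbonFusionCategory CC).
Variable f : {ffun simplex T 2 -> irr V}.

(** The dummy value [tunit] at triples that are not 2-simplices is the same line as the only simple
    representative. *)
Lemma fobj_vect : fobj f = (fun _ _ _ => (CC^o : vectType CC)).
Proof.
apply/funext => i; apply/funext => j; apply/funext => k.
by rewrite /fobj; case: insub.
Qed.

Lemma dim_Vpos_vect i j k l : \dim {:Vpos (fobj f) i j k l} = 1%N.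
Proof. by rewrite fobj_vect; exact: dim_end_line2. Qed.

Lemma index_at_vect (b : multi_index f) i j k l : index_at b i j k l = 0%N.
Proof.
rewrite /index_at; case: insub => // t; case: (b t) => m /=.
by rewrite dim_Vpos_vect; case: m.
Qed.

Lemma card_multi_index_vect : #|multi_index f| = 1%N.
Proof.
rewrite card_dep_ffun /image_mem; elim: (enum _) => //= t s ->.
by rewrite card_ord dim_Vpos_vect.
Qed.

Lemma cell_entry_vect sg (b b' : multi_index f) :
  cell_entry (f := f) 1 sg b' b =
  if tri_signs sg then (basis_scalar CC)^-1 else basis_scalar CC.
Proof.
rewrite /cell_entry !index_at_vect !scale1r.
(* [fobj f] occurs in the types of the vectors, so it is generalised together with its equation
   before rewriting. *)
move: (fobj f) fobj_vect => _ ->.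
by case: tri_signs; [exact: Zpos_entry|exact: Zneg_entry].
Qed.

Lemma tensor_trace_vect : tensor_trace f (fun _ => 1) = 1.
Proof.
rewrite /tensor_trace (eq_bigr (fun=> 1)) => [|b _].
  by rewrite sumr_const cardT -cardE card_multi_index_vect.
rewrite /tensor_entry; under eq_bigr do rewrite cell_entry_vect.
rewrite (bigID (fun sg => tri_signs sg)) /=.
rewrite (eq_bigr (fun=> (basis_scalar CC)^-1)) => [|sg ->] //.
rewrite [X in _ * X](eq_bigr (fun=> basis_scalar CC)) => [|sg /negPf->] //.
rewrite !prodr_const -(card_signs T) exprVn mulVf //.
by rewrite expf_neq0 ?basis_scalar_neq0.
Qed.

End VectCraneYetter.

Lemma qdim_vect_rep (K : fieldType) (a : irr (@Vect K)) : qdim (rep a) = 1.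
Proof.
have /= := Tr_vect_scalar (K^o : vectType K) 1.
by rewrite scale1r dim_line mulr1.
Qed.

Lemma globalDim2_vect (K : fieldType) : globalDim2 (@Vect K) = 1.
Proof.
rewrite /globalDim2 (eq_bigr (fun=> 1)) => [|a _]; last first.
  by rewrite qdim_vect_rep expr1n.
by rewrite sumr_const card_unit.
Qed.

Lemma CraneYetter_vect (R : realType) (M : closedOrientedSmooth4Manifold R)
    (T : orderedTriangulation M) : CraneYetter T Vect = 1.
Proof.
rewrite /CraneYetter (eq_bigr (fun=> 1)) => [|f _]; last first.
  rewrite globalDim2_vect exp1rz tensor_trace_vect big1 ?mulr1 // => b _.
  exact: qdim_vect_rep.
(* [irr Vect] has one element, so there is exactly one colouring. *)
by rewrite sumr_const card_ffun card_unit exp1n.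
Qed.

(** * Factorisation of the twisted partition function *)

Theorem proposition4p8 (R : realType) (G : finGroupType)
    (w : G -> G -> G -> G -> R[i]) (w_cocycle : is_U1_cocycle4 w)
    (M : closedOrientedSmooth4Manifold R) (T : orderedTriangulation M) :
  (forall C : ribbonFusionCategory R[i],
     twistedPartition T C w = DijkgraafWitten T w * CraneYetter T C) /\
  twistedPartition T Vect w = DijkgraafWitten T w.
Proof.
suff E C : twistedPartition T C w = DijkgraafWitten T w * CraneYetter T C.
  by split=> //; rewrite E CraneYetter_vect mulr1.
have Dpow : globalDim2 C ^+ #|{: simplex T 0}| / globalDim2 C ^+ #|{: simplex T 1}|
    = globalDim2 C ^ (#|{: simplex T 0}|%:Z - #|{: simplex T 1}|%:Z).
  have := edges_ge_double_vertices T; have := card_vertices T => nV nE.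
  (* As [2 * |T^0| <= |T^1|], the exponents differ once there is a vertex. The other goal is the
     empty triangulation, which has no edges either. *)
  apply: expr_divr_exprz; last by lia.
  rewrite nV card_edges => n0.
  by rewrite big1 // => v _; have := leq_ltn_trans (leq0n v) (ltn_ord v); lia.
rewrite /twistedPartition (eq_bigl _ _ (@is_coloringE _ _ _ _ _)).
(* The product of the sums over [g] and [f] becomes one sum over pairs, to be compared term by
   term. *)
rewrite /DijkgraafWitten /CraneYetter -mulrA big_distrlr pair_big_dep.
rewrite mulr_sumr /=.
apply: eq_big => [[g f]|[g f] _] /=; first by rewrite andbT.
rewrite -Dpow tensor_trace_weights expr_div_n.
move: (tensor_trace _ _) (\prod_sg _) (\prod_b _) => t DW d.
move: (_ ^+ _) (_ ^+ _) (_ ^+ _) => x y z.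
by ring.
Qed.
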